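(* Let $\mathbb{F}$ be a field with $\mathrm{char}(\mathbb{F})\notin\{2,3\}$, let $Dic_{12}=\langle a,b\mid a^{6}=1,\ b^2=a^{3},\ bab^{-1}=a^{-1}\rangle$ be the dicyclic group of order $12$ and $C_2$ the cyclic group of order $2$. Then $\beta(Dic_{12}\times C_2)=9$.
   Context: For a finite group $G$, a $G$-module is a finite dimensional $\mathbb{F}$-vector space $V$ with a linear action of $G$. $S(V)$ is the symmetric algebra of $V$ (a polynomial algebra on a basis of $V$, with each variable of degree one), on which $G$ acts by $\mathbb{F}$-algebra automorphisms extending the action on $V$, and $S(V)^G$ is the subalgebra of $G$-invariants. $\beta(S(V)^G)$ is the minimal non-negative integer $d$ such that the $\mathbb{F}$-algebra $S(V)^G$ is generated by its homogeneous components of degree at most $d$. The Noether number is $\beta(G)=\sup\{\beta(S(V)^G): V \text{ is a } G\text{-module over }\mathbb{F}\}$. *)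

(* Defs.v *)
From HB Require Import structures.
From mathcomp Require Import all_boot all_order all_algebra all_fingroup.
From mathcomp Require Import all_solvable all_character.
From mathcomp Require Import mpoly.

Set Implicit Arguments.
Unset Strict Implicit.
Unset Printing Implicit Defensive.

Import GRing.Theory.
Local Open Scope ring_scope.

(* The unital F-subalgebra of A generated by the elements satisfying S. *)
Inductive generated_subalg (F : fieldType) (A : algType F) (S : A -> Prop) :
    A -> Prop :=
  | GenSubalgBase x of S x : generated_subalg S x
  | GenSubalgScalar c : generated_subalg S c%:A
  | GenSubalgAdd x y of generated_subalg S x & generated_subalg S y :
      generated_subalg S (x + y)
  | GenSubalgMul x y of generated_subalg S x & generated_subalg S y :
      generated_subalg S (x * y).

Section Invariants.

Variables (F : fieldType) (gT : finGroupType) (G : {group gT}) (n : nat).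
Variable rG : mx_representation F G n.

(* V is the space of row vectors 'rV[F]_n, on which g acts by right           *)
(* multiplication by rG g, and S(V) = {mpoly F[n]}, where 'X_i is the i-th    *)
(* standard basis vector of V; thus g maps 'X_i to row i of rG g. This is a   *)
(* right action, as usual in MathComp: the left module with g acting by       *)
(* rG g^-1 has the same invariants.                                           *)
Definition sym_act (g : gT) (p : {mpoly F[n]}) : {mpoly F[n]} :=
  p \mPo [tuple \sum_(j < n) rG g i j *: 'X_j | i < n].

Definition sym_invariant (p : {mpoly F[n]}) : Prop :=
  forall g, g \in G -> sym_act g p = p.

Definition invariants_generated_upto (d : nat) : Prop :=
  forall p, sym_invariant p ->
    generated_subalg
      (fun q => sym_invariant q /\ exists2 k, (k <= d)%N & q \is k.-homog) p.

Definition is_beta (d : nat) : Prop :=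
  invariants_generated_upto d /\
  forall d', invariants_generated_upto d' -> (d <= d')%N.

End Invariants.

(* b is the (finite) supremum of the numbers beta (S(V)^G). The first clause  *)
(* includes the existence of each beta (S(V)^G), so that it never holds       *)
(* vacuously.                                                                 *)
Definition is_noether_number (F : fieldType) (gT : finGroupType)
    (G : {group gT}) (b : nat) : Prop :=
  (forall n (rG : mx_representation F G n),
      exists2 d, is_beta rG d & (d <= b)%N) /\
  (forall c,
      (forall n (rG : mx_representation F G n) d, is_beta rG d -> (d <= c)%N) ->
    (b <= c)%N).

(* Main.v *)
From Stdlib Require Classical_Prop.
From HB Require Import structures.
Require Import Defs.
From mathcomp Require Import all_boot all_order all_algebra all_fingroup.
From mathcomp Require Import all_solvable all_field all_character.
From mathcomp Require Import ssrcomplements mpoly ring.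

Set Implicit Arguments.
Unset Strict Implicit.
Unset Printing Implicit Defensive.

(** Let K be F with a primitive cube root of unity w adjoined.  Since #|G| is
    invertible, invariants over K are K-linear combinations of averages of
    monomials over F, so degree bounds for generators can be moved between F
    and K, and from a representation to any quotient of it
    ([generated_upto_image], [generated_upto_descent]).

    Upper bound.  Put t = a^4, z = a^3 and let c generate C2.  Over K the
    degree one part of S(V) is spanned by joint eigenvectors of t, z and c.
    Such a letter has a weight in Z/3 * (Z/2 * Z/2); the second factor is
    called its class, and b keeps the class and negates the Z/3 part.  An
    invariant of degree d is a combination of transfers tau(m) = m + b.m of
    products m of d letters of total weight zero.  Modulo products of
    invariants of lower degree,
    - tau(m1 m2) is the opposite of tau((b.m1) m2) if m1 and m2 have weight
      zero, because tau(m1) tau(m2) is the sum of the two;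
    - tau(m1 m2 m3) vanishes if the three factors have weight zero.
    So it suffices that any zero-sum sequence of at least ten weights can be
    cut into three zero-sum blocks, possibly after flipping the sign of the
    Z/3 parts in some zero-sum block ([ten_weights_reducible]).

    That statement is elementary.  Any 2k+2 elements of Z/2 * Z/2 of sum zero
    split into k+1 nonempty zero-sum parts.  If two weights p, q cancel, split
    eight of the others into four parts of class zero: the sums of these parts
    are four elements of Z/3 of sum zero, which split into two zero-sum
    subsets, and p, q form the third block.  In general three of the ten
    weights share a class by the pigeonhole principle; either two of them
    cancel, or two of them are equal with nonzero Z/3 part.  In the second
    case one finds a zero-sum block that contains one of the two equal weights
    and not the other, and flipping it produces two weights that cancel.

    Lower bound.  It is enough to treat the regular representation over F,
    which after extension to K maps onto a five-dimensional representation
    with basis x, y, x', y', u, on which t acts by (w, w^2, w, w^2, 1), z by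
    (-1, -1, -1, -1, 1), c by (1, 1, -1, -1, -1), and b by x -> y -> -x,
    x' -> y' -> -x', u -> u.  The sum of the coefficients at x^6 y x' u and
    x^7 y' u is a derivation on invariants, in the sense of [probeM]: the only
    ways to cut these monomials into two nontrivial monomials of weight zero are
    xy . x^5 x'u, x^6 . yx'u and x^6 . xy'u; no invariant contains xy, and
    the coefficients of yx'u and xy'u are opposite.  So this functional
    kills the algebra generated by invariants of degree at most 8.  It takes
    the value 1 on the invariant x^6 y x' u - x y^6 y' u of degree 9. *)

Import GRing.Theory.
Local Open Scope ring_scope.

(** * Linear substitutions and the Reynolds operator *)

Section LinearSubstitution.

Variables (F K : fieldType) (iota : {rmorphism F -> K}) (n m : nat).

(** The algebra map S(V) -> S(W) of a semilinear map V -> W.  The group action,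
    extension of scalars and passage to a quotient representation are all of
    this form, which makes their compatibilities instances of [lsubst_comp]. *)
Definition lsubst (L : 'M[K]_(n, m)) : {mpoly F[n]} -> {mpoly K[m]} :=
  mmap (@mpolyC m K \o iota) (fun i => \sum_j L i j *: 'X_j).

Variable L : 'M[K]_(n, m).

HB.instance Definition _ := GRing.RMorphism.on (lsubst L).

Lemma lsubstZ c p : lsubst L (c *: p) = iota c *: lsubst L p.
Proof. by rewrite /lsubst mmapZ /= mul_mpolyC. Qed.

Lemma lsubstX i : lsubst L 'X_i = \sum_j L i j *: 'X_j.
Proof. by rewrite /lsubst mmapX mmap1U. Qed.

Lemma lsubstXm u : lsubst L 'X_[u] = \prod_i (lsubst L 'X_i) ^+ u i.
Proof.
by rewrite /lsubst mmapX; apply: eq_bigr => i _; rewrite mmapX mmap1U.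
Qed.

Lemma lsubst_homog d p : p \is d.-homog -> lsubst L p \is d.-homog.
Proof.
move=> /dhomogP hp; rewrite [p]mpolyE rmorph_sum /= big_seq.
apply: rpred_sum => u /hp /= du; rewrite lsubstZ rpredZ // lsubstXm -du mdegE.
apply: (big_rec2 (fun (q : {mpoly K[m]}) e => q \is e.-homog)).
  exact: dhomog1.
move=> i e q _ hq; apply: dhomogM => //; rewrite -[X in X.-homog]mul1n.
apply: dhomogMn; rewrite lsubstX; apply: rpred_sum => j _.
by rewrite rpredZ // dhomogX /= mdeg1.
Qed.

End LinearSubstitution.

Lemma mpoly_rmorph_ext (F : fieldType) n (S : nzRingType)
    (f g : {rmorphism {mpoly F[n]} -> S}) :
  (forall c, f c%:MP = g c%:MP) -> (forall i, f 'X_i = g 'X_i) -> f =1 g.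
Proof.
move=> fgC fgX p; rewrite [p]mpolyE !rmorph_sum; apply: eq_bigr => u _.
rewrite -mul_mpolyC !rmorphM fgC mpolyXE_id !rmorph_prod; congr (_ * _).
by apply: eq_bigr => i _; rewrite !rmorphXn /= fgX.
Qed.

Lemma lsubstC (F K : fieldType) (iota : {rmorphism F -> K}) n m
  (L : 'M[K]_(n, m)) c : lsubst iota L c%:MP = (iota c)%:MP.
Proof. by rewrite /lsubst mmapC. Qed.

Lemma lsubst_comp (F K E : fieldType) (iota : {rmorphism F -> K})
    (kappa : {rmorphism K -> E}) n m l (L : 'M[K]_(n, m)) (M : 'M[E]_(m, l)) p :
  lsubst kappa M (lsubst iota L p)
  = lsubst (kappa \o iota) (map_mx kappa L *m M) p.
Proof.
apply: (@mpoly_rmorph_ext _ _ _ (lsubst kappa M \o lsubst iota L)) => [c|i] /=.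
  by rewrite !lsubstC.
rewrite !lsubstX rmorph_sum /=.
under eq_bigr => j _ do rewrite lsubstZ lsubstX scaler_sumr.
rewrite exchange_big; apply: eq_bigr => k _ /=.
rewrite mxE scaler_suml; apply: eq_bigr => j _.
by rewrite scalerA mxE.
Qed.

Lemma eq_lsubst (F K : fieldType) (iota kappa : {rmorphism F -> K}) n m
    (L M : 'M[K]_(n, m)) : iota =1 kappa -> L = M ->
  lsubst iota L =1 lsubst kappa M.
Proof.
move=> eik -> p; apply: mpoly_rmorph_ext => [c|i]; first by rewrite /= !lsubstC eik.
by rewrite /= !lsubstX.
Qed.

Section Action.

Variables (F : fieldType) (gT : finGroupType) (G : {group gT}) (n : nat).
Variable rG : mx_representation F G n.

Lemma sym_actE g p : sym_act rG g p = lsubst idfun (rG g) p.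
Proof.
rewrite /sym_act /comp_mpoly /lsubst /mmap; apply: eq_bigr => u _.
by congr (_ * _); apply: mmap1_eq => i; rewrite tnth_mktuple.
Qed.

HB.instance Definition _ g := GRing.RMorphism.copy (sym_act rG g)
  (comp_mpoly [tuple \sum_(j < n) rG g i j *: 'X_j | i < n]).

Lemma sym_actC g c : sym_act rG g c%:MP = c%:MP.
Proof. exact: comp_mpolyC. Qed.

Lemma sym_actZ g c p : sym_act rG g (c *: p) = c *: sym_act rG g p.
Proof. exact: comp_mpolyZ. Qed.

Lemma sym_actX g i : sym_act rG g 'X_i = \sum_j rG g i j *: 'X_j.
Proof. by rewrite sym_actE lsubstX. Qed.

Lemma sym_act_homog g d p : p \is d.-homog -> sym_act rG g p \is d.-homog.
Proof. by rewrite sym_actE; apply: lsubst_homog. Qed.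

(** The action is by right multiplication on row vectors, hence the reversed
    order of the factors. *)
Lemma sym_actM g h p : g \in G -> h \in G ->
  sym_act rG g (sym_act rG h p) = sym_act rG (h * g)%g p.
Proof.
move=> Gg Gh; rewrite !sym_actE lsubst_comp.
apply: eq_lsubst => //; rewrite repr_mxM //.
by congr (_ *m _); apply/matrixP => i j; rewrite mxE.
Qed.

Lemma sym_act1 p : sym_act rG 1%g p = p.
Proof.
apply: (@mpoly_rmorph_ext _ _ _ (sym_act rG 1%g) idfun) => [c|i] /=.
  exact: sym_actC.
rewrite sym_actX repr_mx1 (bigD1 i) //= mxE eqxx scale1r big1 ?addr0 // => j.
by move/negPf=> ji; rewrite mxE eq_sym ji scale0r.
Qed.

Definition reynolds p := #|G|%:R^-1 *: \sum_(g in G) sym_act rG g p.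

Lemma reynolds_inv p : sym_invariant rG (reynolds p).
Proof.
move=> h Gh; rewrite /reynolds sym_actZ rmorph_sum /=; congr (_ *: _).
rewrite [RHS](reindex_acts 'R _ Gh) ?astabsR //=; apply: eq_bigr => g Gg.
by rewrite sym_actM.
Qed.

Lemma reynolds_homog d p : p \is d.-homog -> reynolds p \is d.-homog.
Proof.
by move=> hp; apply/rpredZ/rpred_sum => g _; apply: sym_act_homog.
Qed.

Lemma reynolds_id p : #|G|%:R != 0 :> F -> sym_invariant rG p -> reynolds p = p.
Proof.
move=> nz ip; rewrite /reynolds (eq_bigr (fun=> p)) => [|g Gg]; last exact: ip.
by rewrite sumr_const -scaler_nat scalerA mulVf // scale1r.
Qed.

Lemma reynolds_sym_act g p :
  g \in G -> reynolds (sym_act rG g p) = reynolds p.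
Proof.
move=> Gg; rewrite /reynolds; congr (_ *: _).
rewrite [RHS](reindex_inj (mulgI g)) /=; apply: eq_big => [h|h Gh].
  by rewrite groupMl.
by rewrite sym_actM.
Qed.

Lemma reynoldsD p q : reynolds (p + q) = reynolds p + reynolds q.
Proof.
rewrite /reynolds -scalerDr -big_split; congr (_ *: _).
by apply: eq_bigr => g _; rewrite raddfD.
Qed.

Lemma reynoldsZ a p : reynolds (a *: p) = a *: reynolds p.
Proof.
rewrite /reynolds scalerA mulrC -scalerA; congr (_ *: _).
by rewrite scaler_sumr; apply: eq_bigr => g _; rewrite sym_actZ.
Qed.

Lemma reynolds0 : reynolds 0 = 0.
Proof. by rewrite -(scale0r 0) reynoldsZ !scale0r. Qed.

End Action.

(** * Transport of generators along surjections and field extensions *)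

Section Span.

Variables (F K : fieldType) (n m : nat).
Variable phi : {rmorphism {mpoly F[n]} -> {mpoly K[m]}}.

(** The K-span of the images of the polynomials satisfying [P]; here [phi] is
    only semilinear, its source having coefficients in the smaller field. *)
Inductive image_span (P : {mpoly F[n]} -> Prop) : {mpoly K[m]} -> Prop :=
  | ImageSpan0 : image_span P 0
  | ImageSpanD c p q of P p & image_span P q :
      image_span P (c *: phi p + q).

Lemma image_span_sub (P Q : {mpoly F[n]} -> Prop) q :
  (forall p, P p -> Q p) -> image_span P q -> image_span Q q.
Proof.
by move=> PQ; elim=> [|c p {}q Pp _ IH]; constructor => //; apply: PQ.
Qed.

Lemma image_span_base (P : {mpoly F[n]} -> Prop) c p :
  P p -> image_span P (c *: phi p).
Proof.
move=> Pp; rewrite -[_ *: _]addr0; apply: ImageSpanD => //.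
exact: ImageSpan0.
Qed.

Lemma image_span_add P q r :
  image_span P q -> image_span P r -> image_span P (q + r).
Proof.
move=> hq hr; elim: hq => [|c p {}q Pp _ IH]; first by rewrite add0r.
by rewrite -addrA; constructor.
Qed.

Lemma image_span_scale P c q : image_span P q -> image_span P (c *: q).
Proof.
elim=> [|b p {}q Pp _ IH]; first by rewrite scaler0; constructor.
by rewrite scalerDr scalerA; constructor.
Qed.

Lemma image_span_mul (P Q R : {mpoly F[n]} -> Prop) q r :
    (forall p p', P p -> Q p' -> R (p * p')) ->
  image_span P q -> image_span Q r -> image_span R (q * r).
Proof.
move=> PQR hq; elim: hq r => [|c p {}q Pp _ IH] r hr.
  by rewrite mul0r; constructor.
rewrite mulrDl; apply: image_span_add; last exact: IH.
rewrite -scalerAl; apply: image_span_scale; elim: hr => [|b p' r' Qp' _ IHr].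
  by rewrite mulr0; constructor.
by rewrite mulrDr -scalerAr -rmorphM; apply: ImageSpanD => //; apply: PQR.
Qed.

Lemma image_span_sum I (r : seq I) (f : I -> {mpoly K[m]}) P :
  (forall i, image_span P (f i)) -> image_span P (\sum_(i <- r) f i).
Proof.
by move=> hf; elim/big_rec: _ => [|i q _]; [constructor|apply: image_span_add].
Qed.

End Span.

Section Transfer.

Variables (F K : fieldType) (iota : {rmorphism F -> K}).
Variables (gT : finGroupType) (G : {group gT}) (n m : nat).
Variables (rG : mx_representation F G n) (rH : mx_representation K G m).
Variables (L : 'M[K]_(n, m)) (L' : 'M[K]_(m, n)).
Hypothesis L'K : L' *m L = 1%:M.
Hypothesis intertwining :
  forall g, g \in G -> map_mx iota (rG g) *m L = L *m rH g.
Hypothesis nzG : #|G|%:R != 0 :> F.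

Lemma lsubst_sym_act g p : g \in G ->
  lsubst iota L (sym_act rG g p) = sym_act rH g (lsubst iota L p).
Proof.
move=> Gg; rewrite !sym_actE !lsubst_comp; apply: eq_lsubst => //.
by rewrite intertwining //; congr (_ *m _); apply/matrixP => i j; rewrite mxE.
Qed.

Lemma lsubst_inv p : sym_invariant rG p -> sym_invariant rH (lsubst iota L p).
Proof. by move=> ip g Gg; rewrite -lsubst_sym_act ?ip. Qed.

Lemma reynolds_lsubst p :
  reynolds rH (lsubst iota L p) = lsubst iota L (reynolds rG p).
Proof.
rewrite /reynolds lsubstZ fmorphV rmorph_nat rmorph_sum; congr (_ *: _).
by apply: eq_bigr => g Gg; rewrite /= lsubst_sym_act.
Qed.

(** The matrix [L'] is a section of the semilinear surjection given by [L], so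
    each variable of the target lifts to a linear form with coefficients in
    K. *)
Lemma image_span_variable j :
  image_span (lsubst iota L) (fun p => p \is 1.-homog) 'X_j.
Proof.
have -> : 'X_j = \sum_i L' j i *: lsubst iota L 'X_i.
  under eq_bigr => i _ do rewrite lsubstX scaler_sumr.
  rewrite exchange_big (bigD1 j) //= [X in _ + X]big1 ?addr0 => [|k kj].
    under eq_bigr => i _ do rewrite scalerA.
    rewrite -scaler_suml; have /matrixP/(_ j j) := L'K.
    by rewrite !mxE eqxx => ->; rewrite scale1r.
  under eq_bigr => i _ do rewrite scalerA.
  rewrite -scaler_suml; have /matrixP/(_ j k) := L'K.
  by rewrite !mxE eq_sym (negPf kj) => ->; rewrite scale0r.
by apply: image_span_sum => i; apply: image_span_base; rewrite dhomogX /= mdeg1.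
Qed.

Lemma image_span_monomial u :
  image_span (lsubst iota L) (fun p => p \is (mdeg u).-homog) 'X_[u].
Proof.
have one : image_span (lsubst iota L) (fun p => p \is 0.-homog) 1.
  rewrite -(rmorph1 (lsubst iota L)) -[GRing.RMorphism.sort _ _]scale1r.
  by apply: image_span_base; apply: dhomog1.
have mul d e p q : image_span (lsubst iota L) (fun p => p \is d.-homog) p ->
    image_span (lsubst iota L) (fun p => p \is e.-homog) q ->
    image_span (lsubst iota L) (fun p => p \is (d + e).-homog) (p * q).
  by apply: image_span_mul => p1 p2; apply: dhomogM.
rewrite mpolyXE_id mdegE.
apply: (big_rec2 (fun q e =>
  image_span (lsubst iota L) (fun p => p \is e.-homog) q)) => // i e q _.
apply: (mul) => //; elim: (u i) => // k IH; rewrite exprS -[k.+1]add1n.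
by apply: (mul) => //; apply: image_span_variable.
Qed.

(** Averaging commutes with [lsubst iota L], so lifts of an invariant can be
    averaged into invariant lifts. *)
Lemma reynolds_image_span (P Q : {mpoly F[n]} -> Prop) q :
    (forall p, P p -> Q (reynolds rG p)) ->
  image_span (lsubst iota L) P q -> image_span (lsubst iota L) Q (reynolds rH q).
Proof.
move=> PQ; elim=> [|c p {}q Pp _ IH].
  by rewrite reynolds0; constructor.
rewrite reynoldsD reynoldsZ reynolds_lsubst.
by constructor; first apply: PQ.
Qed.

Lemma invariant_image_span q : sym_invariant rH q ->
  image_span (lsubst iota L) (sym_invariant rG) q.
Proof.
move=> iq; have nzK : #|G|%:R != 0 :> K by rewrite -(rmorph_nat iota) fmorph_eq0.
rewrite -(reynolds_id nzK iq).
apply: (@reynolds_image_span (fun=> True)) => [p _|]; first exact: reynolds_inv.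
rewrite [q]mpolyE; apply: image_span_sum => u; apply: image_span_scale.
exact: image_span_sub (image_span_monomial u).
Qed.

Lemma homog_invariant_image_span d q :
    sym_invariant rH q -> q \is d.-homog ->
  image_span (lsubst iota L)
    (fun p => sym_invariant rG p /\ p \is d.-homog) q.
Proof.
move=> iq /dhomogP hq.
have nzK : #|G|%:R != 0 :> K by rewrite -(rmorph_nat iota) fmorph_eq0.
rewrite -(reynolds_id nzK iq).
apply: (@reynolds_image_span (fun p => p \is d.-homog)) => [p hp|].
  by split; [exact: reynolds_inv|exact: reynolds_homog].
rewrite [q]mpolyE big_seq; elim/big_rec: _ => [|u r /hq /= <- hr].
  by constructor.
by apply/image_span_add/hr/image_span_scale/image_span_monomial.
Qed.

(** The algebra of invariants of a quotient representation over an extension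
    field is spanned by images of invariants, so it needs no generators of
    larger degree. *)
Lemma generated_upto_image d :
  invariants_generated_upto rG d -> invariants_generated_upto rH d.
Proof.
move=> gen q /invariant_image_span; elim=> [|c p {}q ip _ IH].
  by rewrite -(scale0r 1); apply: GenSubalgScalar.
apply: GenSubalgAdd => //; rewrite -[GRing.RMorphism.sort _ p]mul1r scalerAl.
apply: GenSubalgMul; first exact: GenSubalgScalar.
elim: (gen p ip) => [r [ir [k kd hr]]|b|r s _ hr _ hs|r s _ hr _ hs].
- apply: GenSubalgBase; split; first exact: lsubst_inv.
  by exists k => //; apply: lsubst_homog.
- by rewrite /= lsubstZ rmorph1; apply: GenSubalgScalar.
- by rewrite rmorphD; apply: GenSubalgAdd.
- by rewrite rmorphM; apply: GenSubalgMul.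
Qed.

(** The converse direction of base change: every homogeneous generator over K
    is a K-combination of images of homogeneous invariants over F of the same
    degree. *)
Lemma generated_image_span d q :
    generated_subalg
      (fun r => sym_invariant rH r /\ exists2 k, (k <= d)%N & r \is k.-homog) q ->
     image_span (lsubst iota L) (generated_subalg
      (fun r => sym_invariant rG r /\ exists2 k, (k <= d)%N & r \is k.-homog)) q.
Proof.
elim=> [r [ir [k kd hr]]|b|r s _ hr _ hs|r s _ hr _ hs].
- apply: image_span_sub (homog_invariant_image_span ir hr) => p' [ip' hp'].
  by apply: GenSubalgBase; split=> //; exists k.
- rewrite -(rmorph1 (lsubst iota L)); apply: image_span_base.
  by rewrite -[1]scale1r; apply: GenSubalgScalar.
- exact: image_span_add.
- by apply: image_span_mul hr hs; apply: GenSubalgMul.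
Qed.

End Transfer.

Section Descent.

Variables (F K : fieldType) (iota : {rmorphism F -> K}) (pi : {additive K -> F}).
Hypothesis pi_linear : forall c x, pi (iota c * x) = c * pi x.
Hypothesis pi1 : pi 1 = 1.
Variables (gT : finGroupType) (G : {group gT}) (n : nat).
Variable rG : mx_representation F G n.
Hypothesis nzG : #|G|%:R != 0 :> F.

Lemma mcoeff_lsubst1 p u : (lsubst iota (1%:M : 'M_n) p)@_u = iota p@_u.
Proof.
rewrite -mcoeff_map_mpoly; congr (_@_u).
apply: (@mpoly_rmorph_ext _ _ _ (lsubst iota 1%:M) (map_mpoly iota)) => [c|i] /=.
  by rewrite lsubstC map_mpolyC.
rewrite lsubstX map_mpolyX (bigD1 i) //= mxE eqxx scale1r big1 ?addr0 // => j.
by move/negPf=> ji; rewrite mxE eq_sym ji scale0r.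
Qed.

(** An F-linear retraction K -> F, applied to the coefficients, turns a
    K-combination of polynomials over F into an F-combination of them. *)
Lemma image_span_descent (S : {mpoly F[n]} -> Prop) q :
    image_span (lsubst iota (1%:M : 'M_n)) (generated_subalg S) q ->
  exists2 r, generated_subalg S r & forall u, r@_u = pi q@_u.
Proof.
elim=> [|c p {}q Sp _ [r Sr rE]].
  exists 0 => [|u]; last by rewrite !mcoeff0 raddf0.
  by rewrite -(scale0r 1); apply: GenSubalgScalar.
exists (pi c *: p + r) => [|u].
  apply: GenSubalgAdd => //; rewrite -[p]mul1r scalerAl.
  by apply: GenSubalgMul => //; apply: GenSubalgScalar.
rewrite !mcoeffD !mcoeffZ rE raddfD mcoeff_lsubst1.
by rewrite [c * _]mulrC pi_linear mulrC.
Qed.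

Lemma generated_upto_descent d :
  invariants_generated_upto (map_repr iota rG) d ->
  invariants_generated_upto rG d.
Proof.
have inter g : g \in G ->
    map_mx iota (rG g) *m (1%:M : 'M_n) = 1%:M *m map_repr iota rG g.
  by rewrite mul1mx mulmx1.
move=> gen p ip.
have := generated_image_span (mul1mx _) inter nzG (gen _ (lsubst_inv inter ip)).
case/image_span_descent => r Sr rE; suff -> : p = r by [].
apply/mpolyP => u; rewrite rE mcoeff_lsubst1 -[iota _]mulr1 pi_linear.
by rewrite pi1 mulr1.
Qed.

End Descent.

Lemma cube_root_exp3 (K : comNzRingType) (w : K) :
  w ^+ 2 + w + 1 = 0 -> w ^+ 3 = 1.
Proof.
move=> w_root; have -> : w ^+ 3 = (w - 1) * (w ^+ 2 + w + 1) + 1 by ring.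
by rewrite w_root mulr0 add0r.
Qed.

(** The retraction [pi], the projection of K onto the line spanned by 1, is what
    [generated_upto_descent] needs. *)
Lemma cube_root_extension (F : fieldType) :
  exists (K : fieldType) (iota : {rmorphism F -> K}) (pi : {additive K -> F})
      (w : K),
    [/\ forall c x, pi (iota c * x) = c * pi x, pi 1 = 1
      & w ^+ 2 + w + 1 = 0].
Proof.
pose p : {poly F} := 'X^2 + 'X + 1.
have hornerp (R : comNzRingType) (x : R) : ('X^2 + 'X + 1).[x] = x ^+ 2 + x + 1.
  by rewrite !hornerE.
have sp : size p = 3%N.
  rewrite /p -addrA size_polyDl size_polyXn // (leq_ltn_trans (size_polyD _ _)) //.
  by rewrite size_polyX size_poly1.
have [[x rx]|norx] := Classical_Prop.classic (exists x, root p x).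
  exists F, idfun, idfun, x; split=> //.
  by rewrite -hornerp; apply/rootP.
have /irredp_FAdjoin[L _ [w rw _]] : irreducible_poly p.
  apply: cubic_irreducible; first by rewrite sp.
  by move=> x; apply/negP => rx; case: norx; exists x.
pose one_tuple : 1.-tuple L := [tuple 1].
have fr : free one_tuple by rewrite /= seq1_free oner_neq0.
pose f (x : L) : F := coord one_tuple ord0 (projv <<one_tuple>> x).
have addf : additive f by move=> x y; rewrite /f !linearB.
pose fA := GRing.isAdditive.Build L F f addf.
pose pi : {additive L -> F} := HB.pack f fA.
exists L, (in_alg L), pi, w; split=> [c x||].
- by rewrite /pi /= /f mulr_algl !linearZ.
- rewrite /pi /= /f projv_id; first by rewrite (coord_free ord0 ord0 fr).
  by rewrite memv_span // mem_head.
- rewrite -hornerp; apply/rootP; move: rw.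
  by rewrite /p !rmorphD /= map_polyXn map_polyX rmorph1.
Qed.

(** * Zero-sum sequences of weights *)

(** Characters of the abelian group generated by t, z and c, written additively:
    the Z/3 part belongs to t, the two Z/2 parts, called the class, to z and
    c. *)
Notation weight := ('Z_3 * ('Z_2 * 'Z_2))%type.

(** The effect of conjugation by b, which inverts t and centralises z and c. *)
Definition flip (w : weight) : weight := (- w.1, w.2).

Lemma flip_additive : additive flip.
Proof. by move=> u v; congr pair; rewrite /= opprD. Qed.

HB.instance Definition _ := GRing.isAdditive.Build weight weight flip flip_additive.

Definition wsum (s : seq weight) : weight := \sum_(w <- s) w.

Definition block (s : seq weight) := (s != [::]) && (wsum s == 0).

(** These rules mirror the relations that hold between transfers of products of
    semi-invariants, modulo products of invariants of lower degree: see
    [transferM3] for the first and [transferM] for the second. *)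
Inductive reducible : seq weight -> Prop :=
  | ReducibleSplit s1 s2 s3 of block s1 & block s2 & block s3 :
      reducible (s1 ++ s2 ++ s3)
  | ReducibleFlip s1 s2 of block s1 & block s2 & reducible (map flip s1 ++ s2) :
      reducible (s1 ++ s2)
  | ReduciblePerm s s' of perm_eq s s' & reducible s : reducible s'.

Lemma wsum_cat s t : wsum (s ++ t) = wsum s + wsum t.
Proof. exact: big_cat. Qed.

Lemma wsum_cons w s : wsum (w :: s) = w + wsum s.
Proof. exact: big_cons. Qed.

Lemma wsum_nil : wsum [::] = 0.
Proof. exact: big_nil. Qed.

Lemma perm_wsum s t : perm_eq s t -> wsum s = wsum t.
Proof. exact: perm_big. Qed.

Lemma wsum_flip s : wsum (map flip s) = flip (wsum s).
Proof. by rewrite /wsum big_map raddf_sum. Qed.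

Lemma wsum_flatten Bs : wsum (flatten Bs) = wsum (map wsum Bs).
Proof.
elim: Bs => [|B Bs IH]; first by rewrite !wsum_nil.
by rewrite /= wsum_cat wsum_cons IH.
Qed.

Lemma perm_map_lift (S T : eqType) (f : S -> T) (s : seq S) (t : seq T) :
  perm_eq t (map f s) -> exists2 s', perm_eq s' s & map f s' = t.
Proof.
case: s => [|x s']; first by move=> /perm_nilP ->; exists [::].
move: (x :: s') => s /(perm_iotaP (f x)) [Is pIs ->].
rewrite size_map in pIs; exists (map (nth x s) Is).
  by apply/(perm_iotaP x); exists Is.
rewrite -map_comp; apply/eq_in_map => i; rewrite (perm_mem pIs) mem_iota /=.
by move=> lt_i; rewrite (nth_map x).
Qed.

Lemma map_cat_inv (S T : Type) (f : S -> T) s t1 t2 : map f s = t1 ++ t2 ->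
  exists s1 s2, [/\ s = s1 ++ s2, map f s1 = t1 & map f s2 = t2].
Proof.
move=> e; exists (take (size t1) s), (drop (size t1) s).
by rewrite cat_take_drop map_take map_drop e take_size_cat // drop_size_cat.
Qed.

Lemma block_flatten Bs :
  block (map wsum Bs) -> [::] \notin Bs -> block (flatten Bs).
Proof.
case/andP=> nz s0 nB; apply/andP; split; last by rewrite wsum_flatten.
by case: Bs nz nB {s0} => [|[|w B] Bs] //=; rewrite in_cons.
Qed.

(** Coarse-graining: a reduction of the sums of some parts is also a reduction
    of the concatenated parts, since flipping a sum flips its summands.  It
    lets the parts be handled as single weights. *)
Lemma reducible_flatten Bs :
  reducible (map wsum Bs) -> [::] \notin Bs -> reducible (flatten Bs).
Proof.
move eBs: (map wsum Bs) => s red.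
elim: red Bs eBs => {s}[s1 s2 s3 b1 b2 b3|s1 s2 b1 b2 _ IH|s s' ss' _ IH] Bs.
- case/map_cat_inv=> B1 [B23 [-> e1 /map_cat_inv[B2 [B3 [-> e2 e3]]]]].
  rewrite !mem_cat !negb_or => /and3P[n1 n2 n3]; rewrite !flatten_cat.
  by apply: ReducibleSplit; apply: block_flatten; rewrite ?e1 ?e2 ?e3.
- case/map_cat_inv=> B1 [B2 [-> e1 e2]].
  rewrite mem_cat negb_or flatten_cat => /andP[n1 n2].
  apply: ReducibleFlip; rewrite ?block_flatten ?e1 ?e2 //.
  rewrite map_flatten -flatten_cat; apply: IH.
    rewrite map_cat e2 -e1 -!map_comp; congr (_ ++ _).
    by apply: eq_map => B /=; rewrite wsum_flip.
  rewrite mem_cat negb_or n2 andbT.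
  by apply/mapP => -[[|w B] // B1n _]; rewrite B1n in n1.
- move=> eBs nB; rewrite -eBs in ss'.
  have [Cs CB eCs] := perm_map_lift ss'.
  apply: (ReduciblePerm (perm_flatten CB)); apply: IH => //.
  by rewrite (perm_mem CB).
Qed.

(** If none of the four is zero, then two of them are 1 and two are -1, as their
    sum vanishes; so [a] cancels with one of the others. *)
Lemma Z3_four_zero_sum (a b c d : 'Z_3) : a + b + c + d = 0 ->
  [|| a == 0, b == 0, c == 0, d == 0, a + b == 0, a + c == 0 | a + d == 0].
Proof.
move: a b c d.
by do 4!(case=> [[|[|[|//]]] ?]).
Qed.

Lemma four_atoms_split s : size s = 4 -> {in s, forall w : weight, w.2 = 0} ->
  wsum s = 0 -> exists s1 s2, [/\ block s1, block s2 & perm_eq s (s1 ++ s2)].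
Proof.
case: s => [|a [|b [|c [|d [|? ?]]]]] // _ cl s0.
have split s1 s2 : s1 != [::] -> s2 != [::] -> (wsum s1).1 == 0 ->
   perm_eq [:: a; b; c; d] (s1 ++ s2) ->
   exists s1 s2, [/\ block s1, block s2 & perm_eq [:: a; b; c; d] (s1 ++ s2)].
  move=> n1 n2 /eqP z1 p12; exists s1, s2.
  have z : wsum s1 = 0.
    rewrite [wsum s1]surjective_pairing z1; congr pair.
    rewrite /wsum (raddf_sum (@snd _ _)) big_seq big1 // => w ws.
    by apply: cl; rewrite (perm_mem p12) mem_cat ws.
  split=> //; rewrite /block ?n1 ?n2 /= ?z //.
  by move: s0; rewrite (perm_wsum p12) wsum_cat z add0r => ->.
have /Z3_four_zero_sum : a.1 + b.1 + c.1 + d.1 = 0.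
  have := congr1 fst s0; rewrite /wsum !big_cons big_nil /= => <-.
  by rewrite !addrA addr0.
case/or4P=> [||| /or4P[]] z.
- by apply: (split [:: a] [:: b; c; d]); rewrite ?wsum_cons ?wsum_nil ?addr0.
- apply: (split [:: b] [:: a; c; d]); rewrite ?wsum_cons ?wsum_nil ?addr0 //.
  by apply/permPl/(perm_catCA [:: a] [:: b] [:: c; d]).
- apply: (split [:: c] [:: a; b; d]); rewrite ?wsum_cons ?wsum_nil ?addr0 //.
  by apply/permPl/(perm_catCA [:: a; b] [:: c] [:: d]).
- apply: (split [:: d] [:: a; b; c]); rewrite ?wsum_cons ?wsum_nil ?addr0 //.
  by apply/permPl/(perm_catCA [:: a; b; c] [:: d] [::]).
- by apply: (split [:: a; b] [:: c; d]); rewrite ?wsum_cons ?wsum_nil ?addr0.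
- apply: (split [:: a; c] [:: b; d]); rewrite ?wsum_cons ?wsum_nil ?addr0 //.
  by rewrite perm_cons; apply/permPl/(perm_catCA [:: b] [:: c] [:: d]).
- apply: (split [:: a; d] [:: b; c]); rewrite ?wsum_cons ?wsum_nil ?addr0 //.
  by rewrite perm_cons; apply/permPl/(perm_catCA [:: b; c] [:: d] [::]).
Qed.

Definition atoms (Bs : seq (seq weight)) :=
  ([::] \notin Bs) && all (fun B => (wsum B).2 == 0) Bs.

(** The atom of sum zero is a block, and the other four split into two blocks
    by [four_atoms_split]. *)
Lemma five_atoms_zero Bs : size Bs = 5 -> atoms Bs -> wsum (flatten Bs) = 0 ->
  0 \in map wsum Bs -> reducible (flatten Bs).
Proof.
move=> sz /andP[nB /allP cB] s0 z.
apply: reducible_flatten => //; rewrite wsum_flatten in s0.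
have pz := perm_to_rem z; set s := rem 0 _ in pz.
have ss : size s = 4 by rewrite size_rem // size_map sz.
have cs : {in s, forall w, w.2 = 0}.
  by move=> w /mem_rem /mapP[B BB ->]; apply/eqP/cB.
have ws : wsum s = 0 by rewrite -s0 (perm_wsum pz) wsum_cons add0r.
have [s1 [s2 [b1 b2 p12]]] := four_atoms_split ss cs ws.
apply: (@ReduciblePerm ([:: 0] ++ s1 ++ s2)).
  by rewrite perm_sym (permPl pz) perm_cons.
by apply: ReducibleSplit; rewrite // /block wsum_cons wsum_nil addr0 eqxx.
Qed.

Lemma dup_perm (S T : eqType) (f : S -> T) s : ~~ uniq (map f s) ->
  exists p q t, f p = f q /\ perm_eq s [:: p, q & t].
Proof.
elim: s => //= w s IH; rewrite negb_and negbK => /orP[/mapP[q sq e]|/IH].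
  by exists w, q, (rem q s); rewrite perm_cons perm_to_rem.
case=> p [q [t [e st]]]; exists p, q, (w :: t); split=> //.
rewrite -(perm_cons w) in st; rewrite (permPl st).
exact/permPl/(perm_catCA [:: w] [:: p; q] t).
Qed.

(** Four elements of the Klein group contain 0 or a repeated element, since it
    has only three nonzero elements. *)
Lemma short_atom s : (3 < size s)%N ->
  exists B t, [/\ perm_eq s (B ++ t), B != [::], (size B <= 2)%N
                & (wsum B).2 = 0].
Proof.
move=> sz; have [/mapP[w sw w0]|n0] := boolP (0 \in map snd s).
  by exists [:: w], (rem w s); rewrite perm_to_rem // wsum_cons wsum_nil addr0.
have /dup_perm[p [q [t [e st]]]] : ~~ uniq (map snd s).
  apply/negP => us; have : uniq (0 :: map snd s) by rewrite /= n0.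
  move/card_uniqP => us'; have := max_card (mem (0 :: map snd s)).
  by rewrite us' /= size_map !card_prod !card_ord => /(leq_trans sz).
exists [:: p; q], t; split=> //.
rewrite !wsum_cons wsum_nil addr0 /= e.
by case: (q.2) => -[[|[|//]] ?] [[|[|//]] ?]; apply/eqP.
Qed.

Lemma many_atoms k s : (k.*2.+1 < size s)%N -> (wsum s).2 = 0 ->
  exists Bs, [/\ size Bs = k.+1, atoms Bs & perm_eq s (flatten Bs)].
Proof.
elim: k s => [|k IH] s sz c0.
  exists [:: s]; rewrite /atoms /= c0 eqxx cats0 inE; split=> //.
  by case: s sz {c0}.
have [|B [t [st nB sB cB]]] := @short_atom s.
  by apply: leq_trans sz; rewrite doubleS.
have [||Bs [sBs /andP[nBs cBs] tBs]] := IH t.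
- rewrite -(ltn_add2l 2); apply: leq_trans (_ : size B + size t <= _)%N.
    by rewrite -size_cat -(perm_size st) !add2n -doubleS.
  by rewrite leq_add2r.
- by move: c0; rewrite (perm_wsum st) wsum_cat /= cB add0r.
exists (B :: Bs); rewrite /atoms /= sBs inE eq_sym (negPf nB) nBs cB eqxx cBs.
by split=> //; rewrite (permPl st) perm_cat2l.
Qed.

(** The pair is an atom of sum zero; the remaining weights, at least eight in
    number, provide four more atoms. *)
Lemma opposite_pair_reducible p q s t : perm_eq s [:: p, q & t] ->
  (7 < size t)%N -> wsum s = 0 -> p + q = 0 -> reducible s.
Proof.
move=> st sz s0 pq0.
have t0 : wsum t = 0.
  by move: s0; rewrite (perm_wsum st) !wsum_cons addrA pq0 add0r.
have [|Bs [sBs /andP[nBs cBs] tBs]] := @many_atoms 3 t sz; first by rewrite t0.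
have pqs : wsum [:: p; q] = 0 by rewrite !wsum_cons wsum_nil addr0.
have ps : perm_eq (flatten ([:: p; q] :: Bs)) s.
  by rewrite perm_sym (permPl st) /= !perm_cons.
apply: (ReduciblePerm ps); apply: five_atoms_zero.
- by rewrite /= sBs.
- by rewrite /atoms /= inE nBs pqs eqxx cBs.
- by rewrite (perm_wsum ps).
- by rewrite /= pqs mem_head.
Qed.

Lemma sum_class_count (s : seq weight) :
  (\sum_(c : 'Z_2 * 'Z_2) count (fun w : weight => w.2 == c) s = size s)%N.
Proof.
rewrite -sum1_size (partition_big (fun w : weight => w.2) predT) //=.
by apply: eq_bigr => c _; rewrite -sum1_count.
Qed.

Lemma three_of_a_class (s : seq weight) : (8 < size s)%N ->
  exists (p q r : weight) t,
  [/\ p.2 = q.2, q.2 = r.2 & perm_eq s [:: p, q, r & t]].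
Proof.
move=> sz.
have [c c3] : exists c, (2 < count (fun w : weight => w.2 == c) s)%N.
  apply/existsP; rewrite -[[exists _, _]]negbK negb_exists.
  apply/negP => /forallP small.
  have : (size s <= \sum_(c : 'Z_2 * 'Z_2) 2)%N.
    by rewrite -sum_class_count; apply: leq_sum => c _; rewrite leqNgt.
  rewrite sum_nat_const card_prod !card_ord.
  by move/(leq_trans sz).
have /allP := filter_all (fun w : weight => w.2 == c) s.
have := perm_filterC (fun w : weight => w.2 == c) s.
move: c3; rewrite -size_filter.
move: (filter (fun w : weight => w.2 == c) s) => u su us cu.
case: u su us cu => [|p [|q [|r t]]] // _ su cu.
exists p, q, r, (t ++ filter (predC (fun w : weight => w.2 == c)) s).
have /eqP ep := cu p (mem_head _ _).
have /eqP eq : q.2 == c by apply: cu; rewrite !inE eqxx orbT.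
have /eqP er : r.2 == c by apply: cu; rewrite !inE eqxx !orbT.
by split; rewrite ?ep ?eq ?er // perm_sym; apply/permPl.
Qed.

Lemma Z3_opposite_or_eq (a c : 'Z_3) : a != 0 -> c != 0 -> (a + c == 0) || (c == a).
Proof.
move=> a0 c0; apply: contraTT (_ : [&& a != 0 & c != 0]); last by rewrite a0.
by move: a c {a0 c0}; do 2!(case=> [[|[|[|//]]] ?]).
Qed.

Lemma Z3_triple (a : 'Z_3) : a + a + a = 0.
Proof. by apply/eqP; case: a => [[|[|[|//]]] ?]. Qed.

Lemma flip_opposite (p q : weight) : p.1 = q.1 -> p.2 = q.2 -> flip p + q = 0.
Proof.
move=> e1 e2; rewrite [LHS]surjective_pairing /= e1 addNr e2.
by case: (q.2) => -[[|[|//]] ?] [[|[|//]] ?]; apply/eqP.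
Qed.

(** Flipping the block that contains [p] turns [p] into the opposite of [q]. *)
Lemma separating_block_reducible s1 s2 p q t :
    perm_eq (s1 ++ s2) [:: p, q & t] -> block s1 -> block s2 ->
    p \in s1 -> q \in s2 -> p.1 = q.1 -> p.2 = q.2 -> (7 < size t)%N ->
  reducible (s1 ++ s2).
Proof.
move=> st b1 b2 p1 q2 e1 e2 sz; apply: ReducibleFlip => //.
apply: (@opposite_pair_reducible (flip p) q _
          (map flip (rem p s1) ++ rem q s2)).
- have P1 := perm_map flip (perm_to_rem p1); have P2 := perm_to_rem q2.
  apply: perm_trans (perm_cat P1 P2) _; rewrite /= perm_cons.
  by rewrite perm_sym -cat1s perm_catCA.
- have P1 := perm_size (perm_to_rem p1); have P2 := perm_size (perm_to_rem q2).
  move: (perm_size st); rewrite !size_cat /= size_map P1 P2 /= addSn addnS.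
  by case=> ->.
- rewrite wsum_cat wsum_flip; case/andP: b1 => _ /eqP ->.
  by case/andP: b2 => _ /eqP ->; rewrite raddf0 addr0.
- exact: flip_opposite.
Qed.

(** If no atom has sum zero, the atom [P] cancels either against one of the
    three atoms other than [Q], or against none of them; in the latter case the
    three have the same sum as [P], and [P] with two of them is a block because
    3 = 0.  Either way a block separates [p] from [q]. *)
Lemma separated_atoms_reducible p q t P Q Bs :
    perm_eq (flatten [:: P, Q & Bs]) [:: p, q & t] -> (7 < size t)%N ->
    wsum (flatten [:: P, Q & Bs]) = 0 -> size Bs = 3 -> atoms [:: P, Q & Bs] ->
    p \in P -> q \in Q -> p.1 = q.1 -> p.2 = q.2 ->
  reducible (flatten [:: P, Q & Bs]).
Proof.
move=> st sz s0 sBs aB pP qQ e1 e2.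
have [z|nz] := boolP (0 \in map wsum [:: P, Q & Bs]).
  by apply: five_atoms_zero; rewrite //= sBs.
case: Bs sBs st s0 aB nz => [|A [|B [|C [|? ?]]]] // _ st s0 aB nz.
have sep U V : perm_eq [:: P; Q; A; B; C] (U ++ V) -> P \in U -> Q \in V ->
    (wsum (flatten U)).1 = 0 -> reducible (flatten [:: P; Q; A; B; C]).
  move=> pUV PU QV zU; have pf := perm_flatten pUV; rewrite flatten_cat in pf.
  have [nB /allP cB] := andP aB.
  have zU0 : wsum (flatten U) = 0.
    rewrite [LHS]surjective_pairing zU; congr pair; rewrite wsum_flatten.
    rewrite /wsum (raddf_sum (@snd _ _)) big_map big_seq big1 // => D DU.
    by apply/eqP/cB; rewrite (perm_mem pUV) mem_cat DU.
  have zV0 : wsum (flatten V) = 0.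
    by move: s0; rewrite (perm_wsum pf) wsum_cat zU0 add0r.
  have pU : p \in flatten U by apply/flattenP; exists P.
  have qV : q \in flatten V by apply/flattenP; exists Q.
  apply: (@ReduciblePerm (flatten U ++ flatten V)); first by rewrite perm_sym.
  apply: (@separating_block_reducible _ _ p q t) => //.
  - by rewrite -(permPl pf).
  - by rewrite /block zU0 eqxx andbT; case: (flatten U) pU.
  - by rewrite /block zV0 eqxx andbT; case: (flatten V) qV.
have nz1 D : D \in [:: P; Q; A; B; C] -> (wsum D).1 != 0.
  move=> DB; apply: contraNneq nz => z; apply/mapP; exists D => //.
  have /andP[_ /allP/(_ D DB)/eqP z2] := aB.
  by rewrite [RHS]surjective_pairing z z2.
have zoe D : D \in [:: P; Q; A; B; C] ->
    ((wsum P).1 + (wsum D).1 == 0) || ((wsum D).1 == (wsum P).1).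
  by move=> DB; apply: Z3_opposite_or_eq; apply: nz1; rewrite // mem_head.
have /orP[/eqP z|/eqP eA] := zoe A ltac:(by rewrite !inE eqxx !orbT).
  apply: (sep [:: P; A] [:: Q; B; C]); rewrite ?inE ?eqxx ?orbT //=.
    by rewrite perm_cons; apply/permPl/(perm_catCA [:: Q] [:: A] [:: B; C]).
  by rewrite cats0 wsum_cat.
have /orP[/eqP z|/eqP eB] := zoe B ltac:(by rewrite !inE eqxx !orbT).
  apply: (sep [:: P; B] [:: Q; A; C]); rewrite ?inE ?eqxx ?orbT //=.
    by rewrite perm_cons; apply/permPl/(perm_catCA [:: Q; A] [:: B] [:: C]).
  by rewrite cats0 wsum_cat.
apply: (sep [:: P; A; B] [:: Q; C]); rewrite ?inE ?eqxx ?orbT //=.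
  by rewrite perm_cons; apply/permPl/(perm_catCA [:: Q] [:: A; B] [:: C]).
by rewrite cats0 !wsum_cat /= eA eB addrA Z3_triple.
Qed.

Lemma class_double (c : 'Z_2 * 'Z_2) : c + c = 0.
Proof. by case: c => -[[|[|//]] ?] [[|[|//]] ?]; apply/eqP. Qed.

(** The third weight [r] of the common class is paired with [p], so that [p] and
    [q] lie in different atoms. *)
Lemma three_nonzero_reducible (p q r : weight) s t :
    perm_eq s [:: p, q, r & t] -> (6 < size t)%N -> wsum s = 0 ->
    p.2 = q.2 -> q.2 = r.2 -> p.1 != 0 -> q.1 != 0 ->
  reducible s.
Proof.
move=> st sz s0 epq eqr np nq.
have /orP[/eqP z|/eqP e1] := Z3_opposite_or_eq np nq.
  apply: (opposite_pair_reducible st) => //.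
  by rewrite [LHS]surjective_pairing /= z epq class_double.
have pr : (wsum [:: p; r]).2 = 0.
  by rewrite !wsum_cons wsum_nil addr0 /= epq eqr class_double.
have st' : perm_eq s ([:: p; r] ++ q :: t).
  by rewrite (permPl st) perm_cons; apply/permPl/(perm_catCA [:: q] [:: r] t).
have [||Bs [sBs /andP[nB cB] tB]] := @many_atoms 3 (q :: t).
- exact: sz.
- by have := congr1 snd s0; rewrite (perm_wsum st') wsum_cat /= pr add0r.
have : q \in flatten Bs by rewrite -(perm_mem tB) mem_head.
case/flattenP=> Q QB qQ; have QB' := perm_to_rem QB.
have st2 : perm_eq (flatten [:: [:: p; r], Q & rem Q Bs]) s.
  rewrite perm_sym (permPl st') perm_cat2l (permPl tB).
  exact: (perm_flatten QB').
apply: (ReduciblePerm st2).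
apply: (@separated_atoms_reducible p q (r :: t)); rewrite ?mem_head //.
- by rewrite (permPl st2).
- by rewrite (perm_wsum st2).
- by rewrite size_rem // sBs.
rewrite /atoms /= pr eqxx inE /=.
by rewrite (perm_mem QB') in nB; rewrite nB; rewrite (perm_all _ QB') in cB.
Qed.

(** Ten weights are needed so that eight remain besides a pair; nine of them
    already guarantee three of the same class.  Two of these three with zero
    Z/3 part cancel each other, because classes have order two. *)
Theorem ten_weights_reducible s : (9 < size s)%N -> wsum s = 0 -> reducible s.
Proof.
move=> sz s0; have [p [q [r [t [epq eqr st]]]]] := three_of_a_class (ltnW sz).
have st1 : perm_eq s [:: q, r, p & t].
  by rewrite (permPl st); apply/permPl/(perm_catCA [:: p] [:: q; r] t).
have st2 : perm_eq s [:: p, r, q & t].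
  by rewrite (permPl st) perm_cons; apply/permPl/(perm_catCA [:: q] [:: r] t).
have szt : (6 < size t)%N by have := perm_size st; move: sz => /[swap] -> /=.
have zz u v t' : perm_eq s [:: u, v & t'] -> u.1 = 0 -> v.1 = 0 -> u.2 = v.2 ->
    reducible s.
  move=> sut u0 v0 euv; apply: (opposite_pair_reducible sut) => //.
    by have := perm_size sut; move: sz => /[swap] -> /=.
  by rewrite [LHS]surjective_pairing /= u0 v0 euv class_double addr0.
have [p0|np] := eqVneq p.1 0; last first.
  have [q0|nq] := eqVneq q.1 0; last exact: three_nonzero_reducible st _ _ _ _ _ _.
  have [r0|nr] := eqVneq r.1 0; first exact: zz st1 _ _ _.
  by apply: three_nonzero_reducible st2 _ _ _ _ _ _; rewrite // epq.
have [q0|nq] := eqVneq q.1 0; first exact: zz st _ _ _.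
have [r0|nr] := eqVneq r.1 0; first by apply: zz st2 _ _ _; rewrite // epq.
by apply: three_nonzero_reducible st1 _ _ _ _ _ _; rewrite // -eqr.
Qed.

(** * The upper bound over a field with a cube root of unity *)

Section UpperBound.

Variables (K : fieldType) (w : K) (gT : finGroupType) (G : {group gT}).
Variables (n : nat) (rG : mx_representation K G n).
Variables (t z c b : gT).
Hypothesis w_root : w ^+ 2 + w + 1 = 0.
Hypothesis nz2 : 2%:R != 0 :> K.
Hypothesis nz3 : 3%:R != 0 :> K.
Hypothesis nzG : #|G|%:R != 0 :> K.
Hypothesis genG : G :=: <<[set t; z; c; b]>>%g.
Hypothesis t3 : (t ^+ 3 = 1)%g.
Hypothesis z2 : (z ^+ 2 = 1)%g.
Hypothesis c2 : (c ^+ 2 = 1)%g.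
Hypothesis b2 : (b ^+ 2 = z)%g.
Hypothesis tz : commute t z.
Hypothesis tc : commute t c.
Hypothesis zc : commute z c.
Hypothesis bc : commute b c.
Hypothesis bt : (b * t = t^-1 * b)%g.

Local Notation act := (sym_act rG).
Local Notation poly := {mpoly K[n]}.

Lemma tG : t \in G. Proof. by rewrite genG mem_gen ?inE ?eqxx ?orbT. Qed.
Lemma zG : z \in G. Proof. by rewrite genG mem_gen ?inE ?eqxx ?orbT. Qed.
Lemma cG : c \in G. Proof. by rewrite genG mem_gen ?inE ?eqxx ?orbT. Qed.
Lemma bG : b \in G. Proof. by rewrite genG mem_gen ?inE ?eqxx ?orbT. Qed.
Hint Resolve tG zG cG bG : core.

Lemma act_comm g h p : g \in G -> h \in G -> commute g h ->
  act g (act h p) = act h (act g p).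
Proof.
by move=> Gg Gh gh; rewrite (sym_actM rG p Gg Gh) (sym_actM rG p Gh Gg) gh.
Qed.

Lemma act_order2 h p : h \in G -> (h ^+ 2 = 1)%g -> act h (act h p) = p.
Proof. by move=> Gh h2; rewrite (sym_actM rG p Gh Gh) -expg2 h2 sym_act1. Qed.

Lemma act_t3 p : act t (act t (act t p)) = p.
Proof.
rewrite (sym_actM rG _ tG tG) (sym_actM rG p (groupM tG tG) tG).
by rewrite -[RHS](sym_act1 rG) -t3 !expgS expg0 mulg1 mulgA.
Qed.

Lemma act_bb p : act b (act b p) = act z p.
Proof. by rewrite (sym_actM rG p bG bG) -expg2 b2. Qed.

Lemma act_bt p : act t (act b p) = act b (act t (act t p)).
Proof.
rewrite (sym_actM rG p tG bG) (sym_actM rG p tG tG).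
rewrite (sym_actM rG p bG (groupM tG tG)) bt; congr (act (_ * b)%g p).
by apply/(mulgI t); rewrite mulgV -t3 !expgS expg0 mulg1.
Qed.

Lemma invariant_generators p :
  act t p = p -> act z p = p -> act c p = p -> act b p = p ->
  sym_invariant rG p.
Proof.
move=> pt pz pc pb.
have sub : G \subset [set g in G | act g p == p].
  have gS : group_set [set g in G | act g p == p].
    apply/group_setP; split=> [|g h].
      by rewrite inE group1 sym_act1 eqxx.
    rewrite !inE => /andP[Gg /eqP pg] /andP[Gh /eqP ph].
    by rewrite groupM // -sym_actM // pg ph eqxx.
  rewrite {1}genG -[[set _ in _ | _]]/(gval (Group gS)) gen_subG.
  apply/subsetP => g; rewrite !inE -!orbA.
  by case/or4P => /eqP ->; rewrite ?pt ?pz ?pc ?pb ?eqxx ?andbT.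
by move=> g /(subsetP sub); rewrite inE => /andP[_ /eqP].
Qed.

Let w3 : w ^+ 3 = 1. Proof. exact: cube_root_exp3. Qed.

Lemma exp_Z3D (i j : 'Z_3) : w ^+ (i + j)%R = w ^+ i * w ^+ j.
Proof. by rewrite -exprD /= (expr_mod _ w3). Qed.

Lemma exp_Z2D (i j : 'Z_2) : (-1) ^+ (i + j)%R = (-1) ^+ i * (-1) ^+ j :> K.
Proof.
have e : (-1) ^+ 2 = 1 :> K by rewrite sqrrN expr1n.
by rewrite -exprD /= (expr_mod _ e).
Qed.

Lemma exp_Z3N (i : 'Z_3) : w ^+ (- i)%R = w ^+ i * w ^+ i.
Proof.
case: i => -[|[|[|//]]] ? /=; rewrite ?expr0 ?mulr1 //.
by rewrite -exprD /= (_ : (2 + 2)%N = 4)%N // exprS w3 mulr1 expr1.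
Qed.

Lemma exp_Z3_eq1 (i : 'Z_3) : w ^+ i = 1 -> i = 0.
Proof.
have w1 : w != 1.
  apply: contra_neq nz3 => e; rewrite -w_root e.
  by ring.
case: i => -[|[|[|//]]] lt_i /= e; apply: val_inj => //=.
  by case/eqP: w1; rewrite -[LHS]expr1.
by case/eqP: w1; rewrite -[LHS]mul1r -e -exprSr w3.
Qed.

Lemma exp_Z2_eq1 (i : 'Z_2) : (-1) ^+ i = 1 :> K -> i = 0.
Proof.
case: i => -[|[|//]] lt_i /= e; apply: val_inj => //=.
case/eqP: nz2; rewrite expr1 in e.
by rewrite -[2%:R]/(1 + 1) -{1}e addNr.
Qed.

Definition semi_invariant (u : weight) (p : poly) :=
  [/\ act t p = w ^+ u.1 *: p, act z p = (-1) ^+ u.2.1 *: p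
    & act c p = (-1) ^+ u.2.2 *: p].

Lemma semi_invariantM u v p q : semi_invariant u p -> semi_invariant v q ->
  semi_invariant (u + v) (p * q).
Proof.
move=> [pt pz pc] [qt qz qc]; split; rewrite rmorphM /=.
- by rewrite pt qt exp_Z3D -scalerAl -scalerAr scalerA.
- by rewrite pz qz exp_Z2D -scalerAl -scalerAr scalerA.
- by rewrite pc qc exp_Z2D -scalerAl -scalerAr scalerA.
Qed.

Lemma semi_invariant1 : semi_invariant 0 1.
Proof. by split; rewrite rmorph1 expr0 scale1r. Qed.

Lemma bz : commute b z.
Proof. by rewrite -b2; apply: commuteX. Qed.

Lemma semi_invariant_flip u p : semi_invariant u p ->
  semi_invariant (flip u) (act b p).
Proof.
move=> [pt pz pc]; split.
- by rewrite act_bt pt sym_actZ pt scalerA sym_actZ /= exp_Z3N.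
- by rewrite act_comm ?pz ?sym_actZ //; apply/commute_sym/bz.
- by rewrite act_comm ?pc ?sym_actZ //; apply/commute_sym/bc.
Qed.

(** On invariants of the subgroup generated by t, z and c, which contains b^2,
    this is the relative transfer to the whole group. *)
Definition transfer p : poly := p + act b p.

Lemma transfer_inv p : semi_invariant 0 p -> sym_invariant rG (transfer p).
Proof.
move=> sp; have := semi_invariant_flip sp; move: sp.
rewrite (raddf0 flip) /semi_invariant !expr0 !scale1r.
case=> pt pz pc [bpt bpz bpc].
apply: invariant_generators; rewrite /transfer raddfD /=.
- by rewrite pt bpt.
- by rewrite pz bpz.
- by rewrite pc bpc.
- by rewrite act_bb pz addrC.
Qed.

(** Hence, modulo decomposable invariants, flipping a factor of weight zero only
    changes the sign of the transfer. *)
Lemma transferM p q : semi_invariant 0 p ->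
  transfer p * transfer q = transfer (p * q) + transfer (act b p * q).
Proof.
move=> [_ pz _]; rewrite /transfer !rmorphM /= act_bb pz expr0 scale1r.
by ring.
Qed.

(** By [transferM] for the factorisations p.(q r), q.(p r) and (p b(q)).r: the
    flipped terms of the first two are the two terms of the third. *)
Lemma transferM3 p q r :
    semi_invariant 0 p -> semi_invariant 0 q -> semi_invariant 0 r ->
  transfer (p * (q * r)) = 2%:R^-1 *:
    (transfer p * transfer (q * r) + transfer q * transfer (p * r)
     - transfer (p * act b q) * transfer r).
Proof.
move=> [_ pz _] [_ qz _] [_ rz _]; rewrite /transfer !rmorphM /= act_bb.
rewrite qz expr0 scale1r; apply: (@scalerI _ _ 2%:R) => //.
by rewrite scalerA divff // scale1r scaler_nat; ring.
Qed.

Lemma transfer_homog d p : p \is d.-homog -> transfer p \is d.-homog.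
Proof. by move=> hp; rewrite rpredD // sym_act_homog. Qed.

Local Notation letter := (weight * nat * poly)%type.

(** Letters carry their weight and degree: neither can be computed from the
    polynomial when it vanishes. *)
Definition homog_letter (l : letter) :=
  [/\ semi_invariant l.1.1 l.2, l.2 \is l.1.2.-homog & (0 < l.1.2)%N].

Definition letters_weight (ls : seq letter) := [seq l.1.1 | l <- ls].
Definition letters_degree (ls : seq letter) := (\sum_(l <- ls) l.1.2)%N.
Definition letters_prod (ls : seq letter) := \prod_(l <- ls) l.2.
Definition flip_letter (l : letter) : letter :=
  (flip l.1.1, l.1.2, act b l.2).

Lemma homog_letter_flip l : homog_letter l -> homog_letter (flip_letter l).
Proof.
case=> sl hl dl; split=> //; first exact: semi_invariant_flip.
exact: sym_act_homog.
Qed.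

Lemma letters_prod_flip ls :
  letters_prod (map flip_letter ls) = act b (letters_prod ls).
Proof. by rewrite /letters_prod big_map rmorph_prod. Qed.

Lemma letters_degree_flip ls :
  letters_degree (map flip_letter ls) = letters_degree ls.
Proof. by rewrite /letters_degree big_map. Qed.

Lemma letters_prod_cat l1 l2 :
  letters_prod (l1 ++ l2) = letters_prod l1 * letters_prod l2.
Proof. exact: big_cat. Qed.

Lemma letters_degree_cat l1 l2 :
  letters_degree (l1 ++ l2) = (letters_degree l1 + letters_degree l2)%N.
Proof. exact: big_cat. Qed.

Lemma letters_prodP (ls : seq letter) : {in ls, forall l, homog_letter l} ->
  semi_invariant (wsum (letters_weight ls)) (letters_prod ls)
  /\ letters_prod ls \is (letters_degree ls).-homog.
Proof.
rewrite /letters_prod /letters_degree.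
elim: ls => [|l ls IH] ok.
  by rewrite !big_nil wsum_nil; split; [exact: semi_invariant1|exact: dhomog1].
have [|sls hls] := IH; first by move=> l' l'ls; apply: ok; rewrite inE l'ls orbT.
have [sl hl _] := ok l (mem_head _ _).
rewrite !big_cons wsum_cons; split; first exact: semi_invariantM.
exact: dhomogM.
Qed.

Lemma letters_degree_gt0 (ls : seq letter) : {in ls, forall l, homog_letter l} ->
  ls != [::] -> (0 < letters_degree ls)%N.
Proof.
case: ls => // l ls ok _; have [_ _ dl] := ok l (mem_head _ _).
by rewrite /letters_degree big_cons ltn_addr.
Qed.

(** Generation in degree at most nine is proved by induction on the degree;
    [lower] is the induction hypothesis. *)
Section Induction.

Variable d : nat.
Local Notation generated := (generated_subalg (fun q : poly =>
  sym_invariant rG q /\ exists2 k, (k <= 9)%N & q \is k.-homog)).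
Hypothesis lower : forall k q, (k < d)%N -> sym_invariant rG q ->
  q \is k.-homog -> generated q.

Lemma generatedZ a q : generated q -> generated (a *: q).
Proof.
move=> gq; rewrite -[q]mul1r scalerAl; apply: GenSubalgMul => //.
exact: GenSubalgScalar.
Qed.

Lemma generatedB p q : generated p -> generated q -> generated (p - q).
Proof.
move=> gp gq; apply: GenSubalgAdd => //.
by rewrite -scaleN1r; apply: generatedZ.
Qed.

Lemma generated_transfer k p : (k < d)%N -> p \is k.-homog ->
  semi_invariant 0 p -> generated (transfer p).
Proof.
by move=> kd hp sp; apply: (lower kd); [apply: transfer_inv|apply: transfer_homog].
Qed.

Lemma blockP (ls : seq letter) : {in ls, forall l, homog_letter l} ->
    block (letters_weight ls) ->
  [/\ semi_invariant 0 (letters_prod ls),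
      letters_prod ls \is (letters_degree ls).-homog
    & (0 < letters_degree ls)%N].
Proof.
move=> ok /andP[nz /eqP s0]; have [sp hp] := letters_prodP ok.
rewrite s0 in sp; split=> //; apply: letters_degree_gt0 => //.
by case: ls nz {ok s0 sp hp}.
Qed.

Lemma reducible_generated s (ls : seq letter) :
    reducible s -> letters_weight ls = s ->
    {in ls, forall l, homog_letter l} -> letters_degree ls = d ->
  generated (transfer (letters_prod ls)).
Proof.
have inl (l1 l2 : seq letter) : {in l1 ++ l2, forall l, homog_letter l} ->
    {in l1, forall l, homog_letter l} /\ {in l2, forall l, homog_letter l}.
  by move=> ok; split=> l ll; apply: ok; rewrite mem_cat ll ?orbT.
move=> red.
elim: red ls => {s}[s1 s2 s3 bl1 bl2 bl3|s1 s2 bl1 bl2 _ IH|s s' ss' _ IH] ls.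
- case/map_cat_inv=> l1 [l23 [-> e1 /map_cat_inv[l2 [l3 [-> e2 e3]]]]].
  case/inl=> ok1 /inl[ok2 ok3]; rewrite !letters_degree_cat => dE.
  rewrite -e1 in bl1; rewrite -e2 in bl2; rewrite -e3 in bl3.
  have [s1' h1 d1] := blockP ok1 bl1; have [s2' h2 d2] := blockP ok2 bl2.
  have [s3' h3 d3] := blockP ok3 bl3.
  have s23 := semi_invariantM s2' s3'; have s13 := semi_invariantM s1' s3'.
  have s12 := semi_invariantM s1' (semi_invariant_flip s2').
  have h12 := dhomogM h1 (sym_act_homog rG b h2).
  rewrite !addr0 in s23 s13 s12.
  rewrite !letters_prod_cat transferM3 //; apply: generatedZ; apply: generatedB.
    apply: GenSubalgAdd; apply: GenSubalgMul.
    + apply: generated_transfer h1 s1'.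
      by rewrite -dE -addn1 leq_add2l addn_gt0 d2.
    + apply: generated_transfer (dhomogM h2 h3) s23.
      by rewrite -dE -add1n leq_add2r.
    + apply: generated_transfer h2 s2'.
      by rewrite -dE addnCA -addn1 leq_add2l addn_gt0 d1.
    + apply: generated_transfer (dhomogM h1 h3) s13.
      by rewrite -dE addnCA -add1n leq_add2r.
  apply: GenSubalgMul.
  + apply: generated_transfer h12 s12.
    by rewrite -dE addnA -addn1 leq_add2l.
  + apply: generated_transfer h3 s3'.
    by rewrite -dE addnA -add1n leq_add2r addn_gt0 d1.
- case/map_cat_inv=> l1 [l2 [-> e1 e2]] okl; have [ok1 ok2] := inl _ _ okl.
  rewrite letters_degree_cat => dE.
  rewrite -e1 in bl1; rewrite -e2 in bl2.
  have [s1' h1 d1] := blockP ok1 bl1; have [s2' h2 d2] := blockP ok2 bl2.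
  have := IH (map flip_letter l1 ++ l2).
  rewrite letters_degree_cat letters_degree_flip !letters_prod_cat.
  rewrite letters_prod_flip => IHfl.
  set q := transfer (act b (letters_prod l1) * letters_prod l2) in IHfl.
  rewrite -[transfer _](addrK q) {2}/q.
  rewrite -transferM //; apply: generatedB.
    apply: GenSubalgMul.
      by apply: generated_transfer h1 s1'; rewrite -dE -addn1 leq_add2l.
    by apply: generated_transfer h2 s2'; rewrite -dE -add1n leq_add2r.
  apply: IHfl => //; first by rewrite -e1 -e2 /letters_weight map_cat -!map_comp.
  move=> l; rewrite mem_cat => /orP[/mapP[l' ll' ->]|]; last exact: ok2.
  exact/homog_letter_flip/ok1.
- move=> e ok dE; rewrite -e in ss'; have [ls' p' e'] := perm_map_lift ss'.
  have -> : letters_prod ls = letters_prod ls'.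
    by rewrite /letters_prod (perm_big _ p').
  apply: IH => // [l|]; first by rewrite (perm_mem p'); apply: ok.
  by rewrite /letters_degree (perm_big _ p').
Qed.

Lemma reynolds_eigen g a p : g \in G -> act g p = a *: p -> a != 1 ->
  reynolds rG p = 0.
Proof.
move=> Gg gp a1; have := reynolds_sym_act rG p Gg; rewrite gp reynoldsZ => /eqP.
rewrite -subr_eq0 -[X in _ - X]scale1r -scalerBl scaler_eq0 subr_eq0.
by rewrite (negPf a1) => /eqP.
Qed.

(** Averaging over the group kills eigenvectors of nontrivial eigenvalue. *)
Lemma reynolds_semi_invariant u p : semi_invariant u p -> u != 0 ->
  reynolds rG p = 0.
Proof.
case: u => [i [j k]] [/= pt pz pc] nu.
have [i1|/(reynolds_eigen tG pt) //] := eqVneq (w ^+ i) 1.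
have [j1|/(reynolds_eigen zG pz) //] := eqVneq ((-1) ^+ j : K) 1.
have [k1|/(reynolds_eigen cG pc) //] := eqVneq ((-1) ^+ k : K) 1.
by rewrite (exp_Z3_eq1 i1) (exp_Z2_eq1 j1) (exp_Z2_eq1 k1) eqxx in nu.
Qed.

Lemma reynolds_transfer p : semi_invariant 0 p ->
  reynolds rG p = 2%:R^-1 *: transfer p.
Proof.
move=> sp; rewrite -(reynolds_id nzG (transfer_inv sp)) reynoldsD.
rewrite (reynolds_sym_act rG p bG) -mulr2n -scaler_nat scalerA mulVf //.
by rewrite scale1r.
Qed.

Lemma generated_reynolds_letters (ls : seq letter) : (9 < size ls)%N ->
    {in ls, forall l, homog_letter l} -> letters_degree ls = d ->
  generated (reynolds rG (letters_prod ls)).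
Proof.
move=> sz ok dE; have [sp _] := letters_prodP ok.
have [s0|ns] := eqVneq (wsum (letters_weight ls)) 0; last first.
  rewrite (reynolds_semi_invariant sp ns) -(scale0r 1).
  exact: GenSubalgScalar.
rewrite s0 in sp; rewrite (reynolds_transfer sp); apply: generatedZ.
apply: reducible_generated erefl ok dE; apply: ten_weights_reducible => //.
by rewrite size_map.
Qed.

(** The projections to the eigenspaces of an involution [h], of eigenvalue
    (-1)^e, and of the element t of order three, of eigenvalue w^i. *)
Definition proj2 h (e : 'Z_2) p : poly :=
  2%:R^-1 *: (p + (-1) ^+ e *: act h p).

Definition proj3 (i : 'Z_3) p : poly :=
  3%:R^-1 *: (p + (w ^+ i) ^+ 2 *: act t p + w ^+ i *: act t (act t p)).

Lemma sum_proj2 h p : \sum_e proj2 h e p = p.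
Proof.
rewrite big_ord_recl big_ord1 /proj2 -scalerDr expr0 expr1 scale1r scaleN1r.
rewrite addrACA subrr addr0 -mulr2n -scaler_nat scalerA mulVf //.
by rewrite scale1r.
Qed.

Lemma sum_proj3 p : \sum_i proj3 i p = p.
Proof.
rewrite !big_ord_recl big_ord0 /proj3 addr0 -!scalerDr /= /bump /= expr0.
apply: (@scalerI _ _ 3%:R) => //; rewrite scalerA divff // scale1r scaler_nat.
have w2 : w ^+ 2 = - w - 1.
  by apply/eqP; rewrite -subr_eq0 -w_root; apply/eqP; ring.
rewrite !expr1 !expr1n !scale1r.
have -> : (w ^+ (1 + 1)) ^+ 2 = w.
  by rewrite -exprM (exprS w 3) w3 mulr1.
rewrite w2 -!mul_mpolyC mpolyCB mpolyCN mpolyC1.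
by ring.
Qed.

Lemma proj2_eigen h e p : h \in G -> (h ^+ 2 = 1)%g ->
  act h (proj2 h e p) = (-1) ^+ e *: proj2 h e p.
Proof.
move=> Gh h2; rewrite /proj2 sym_actZ raddfD /= sym_actZ act_order2 //.
rewrite [RHS]scalerA [in RHS]mulrC -[RHS]scalerA; congr (_ *: _).
rewrite scalerDr scalerA -exprD addnn -mul2n exprM sqrrN !expr1n.
by rewrite scale1r addrC.
Qed.

Lemma proj3_eigen i p : act t (proj3 i p) = w ^+ i *: proj3 i p.
Proof.
rewrite /proj3 sym_actZ !(raddfD (act t)) /= !sym_actZ act_t3.
rewrite [RHS]scalerA [in RHS]mulrC -[RHS]scalerA; congr (_ *: _).
have i3 : w ^+ i * (w ^+ i) ^+ 2 = 1.
  by rewrite -exprS -exprM mulnC exprM w3 expr1n.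
by rewrite !scalerDr !scalerA i3 scale1r -expr2 addrC addrA.
Qed.

Lemma proj2_act h e g p : h \in G -> g \in G -> commute h g ->
  act g (proj2 h e p) = proj2 h e (act g p).
Proof.
move=> Gh Gg hg; rewrite /proj2 sym_actZ raddfD /= sym_actZ.
by rewrite (act_comm p Gg Gh (commute_sym hg)).
Qed.

Lemma proj3_act i g p : g \in G -> commute t g ->
  act g (proj3 i p) = proj3 i (act g p).
Proof.
move=> Gg /commute_sym gt; rewrite /proj3 sym_actZ !(raddfD (act g)) /= !sym_actZ.
by rewrite !(act_comm _ Gg tG gt).
Qed.

Definition weight_proj (u : weight) p : poly :=
  proj3 u.1 (proj2 z u.2.1 (proj2 c u.2.2 p)).

Lemma proj2Z h e a p : proj2 h e (a *: p) = a *: proj2 h e p.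
Proof.
rewrite /proj2 sym_actZ [X in _ + X]scalerA [X in X *: act _ _]mulrC.
by rewrite -scalerA -scalerDr !scalerA mulrC.
Qed.

Lemma proj3Z e a p : proj3 e (a *: p) = a *: proj3 e p.
Proof.
rewrite /proj3 !sym_actZ [_ ^+ 2 *: (_ *: _)]scalerA [_ ^+ 2 * a]mulrC.
rewrite [_ *: (a *: act _ (act _ _))]scalerA [w ^+ e * a]mulrC.
by rewrite -!(scalerA a) -!scalerDr !scalerA mulrC.
Qed.

Lemma weight_proj_semi u p : semi_invariant u (weight_proj u p).
Proof.
rewrite /weight_proj; split; first exact: proj3_eigen.
  by rewrite proj3_act // (proj2_eigen _ _ zG z2) proj3Z.
rewrite proj3_act // (proj2_act _ _ zG cG zc) (proj2_eigen _ _ cG c2).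
by rewrite proj2Z proj3Z.
Qed.

Lemma sum_weight_proj p : p = \sum_u weight_proj u p.
Proof.
rewrite -(pair_bigA _ (fun i u => weight_proj (i, u) p)) /= /weight_proj /=.
rewrite exchange_big /=.
under eq_bigr => u _ do rewrite sum_proj3.
rewrite -(pair_bigA _ (fun i j => proj2 z i (proj2 c j p))) exchange_big /=.
by under eq_bigr => u _ do rewrite sum_proj2; rewrite sum_proj2.
Qed.

Lemma weight_proj_homog k u p : p \is k.-homog -> weight_proj u p \is k.-homog.
Proof.
have h2 h e q : q \is k.-homog -> proj2 h e q \is k.-homog.
  by move=> hq; rewrite rpredZ // rpredD // rpredZ // sym_act_homog.
move=> hp; have hq := h2 z u.2.1 _ (h2 c u.2.2 _ hp).
by rewrite rpredZ // !rpredD // ?rpredZ // ?sym_act_homog.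
Qed.

(** Variables are replaced one at a time by the sum of their weight components,
    which are appended to the list of letters. *)
Lemma generated_reynolds_monomial u (ls : seq letter) : (9 < d)%N ->
    {in ls, forall l, homog_letter l /\ l.1.2 = 1%N} ->
    (size ls + mdeg u = d)%N ->
  generated (reynolds rG (letters_prod ls * 'X_[u])).
Proof.
move=> d9; move Dk: (mdeg u) => k; elim: k u Dk ls => [|k IH] u Dk ls ok dE.
  move/eqP: Dk; rewrite mdeg_eq0 => /eqP ->; rewrite mpolyX0 mulr1.
  rewrite addn0 in dE; apply: generated_reynolds_letters.
  - by rewrite dE.
  - by move=> l /ok[].
  rewrite -dE /letters_degree big_seq (eq_bigr (fun=> 1%N)) => [|l /ok[] //].
  by rewrite -big_seq sum1_size.
have [i ui] : exists i, u i != 0%N.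
  apply/existsP; rewrite -negb_forall; apply/negP => /forallP u0.
  by move: Dk; rewrite mdegE big1 // => i _; apply/eqP.
have -> : u = (U_(i) + (u - U_(i)))%MM.
  by rewrite addmC submK // lep1mP.
rewrite mpolyXD mulrA [in 'X_i](sum_weight_proj 'X_i) mulr_sumr mulr_suml.
have Rsum I (r : seq I) (f : I -> poly) :
    (forall j, generated (reynolds rG (f j))) ->
    generated (reynolds rG (\sum_(j <- r) f j)).
  move=> gf; elim/big_ind: _ => // [|p q gp gq].
    by rewrite reynolds0 -(scale0r 1); apply: GenSubalgScalar.
  by rewrite reynoldsD; apply: GenSubalgAdd.
apply: Rsum => v.
have := IH (u - U_(i))%MM _ ((v, 1%N, weight_proj v 'X_i) :: ls).
rewrite {1}/letters_prod big_cons /= [_ * \prod_(_ <- _) _]mulrC; apply.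
- apply: succn_inj; rewrite -Dk -[in RHS](submK (_ : U_(i) <= u)%MM) ?lep1mP //.
  by rewrite mdegD mdeg1 addn1.
- move=> l; rewrite inE => /orP[/eqP ->|/ok //]; split=> //; split=> //.
    exact: weight_proj_semi.
  by apply: weight_proj_homog; rewrite dhomogX /= mdeg1.
- by rewrite -dE addSnnS.
Qed.

Lemma generated_invariant q : (9 < d)%N -> sym_invariant rG q ->
  q \is d.-homog -> generated q.
Proof.
move=> d9 iq /dhomogP hq; rewrite -(reynolds_id nzG iq) [q]mpolyE big_seq.
elim/big_rec: _ => [|u p uq gp].
  by rewrite reynolds0 -(scale0r 1); apply: GenSubalgScalar.
rewrite reynoldsD reynoldsZ; apply: GenSubalgAdd => //; apply: generatedZ.
have := @generated_reynolds_monomial u [::] d9; rewrite /letters_prod big_nil mul1r.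
by apply=> //; rewrite add0n; apply: hq.
Qed.

End Induction.

(** Arbitrary invariants are combinations of averages of monomials, hence sums
    of homogeneous ones. *)
Theorem generated_upto9 : invariants_generated_upto rG 9.
Proof.
have gen_homog d q : sym_invariant rG q -> q \is d.-homog ->
    generated_subalg (fun q : poly =>
      sym_invariant rG q /\ exists2 k, (k <= 9)%N & q \is k.-homog) q.
  elim/ltn_ind: d q => d IH q iq hq.
  have [d9|d9] := leqP d 9; first by apply: GenSubalgBase; split=> //; exists d.
  by apply: (@generated_invariant d) => // k p kd ip hp; apply: IH hp.
move=> q iq; rewrite -(reynolds_id nzG iq) [q]mpolyE.
elim/big_rec: _ => [|u p _ gp].
  by rewrite reynolds0 -(scale0r 1); apply: GenSubalgScalar.
rewrite reynoldsD reynoldsZ; apply: GenSubalgAdd => //; apply: generatedZ.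
apply: (gen_homog (mdeg u)); first exact: reynolds_inv.
by apply: reynolds_homog; rewrite dhomogX.
Qed.

End UpperBound.

(** * An indecomposable invariant of degree nine *)

Lemma mcoeffM_support (R : comNzRingType) n (p q : {mpoly R[n]}) m
    (ks : seq 'X_{1..n}) :
    uniq ks -> {in ks, forall k, (k <= m)%MM} ->
    (forall k, (k <= m)%MM -> k \notin ks -> p@_k = 0) ->
  (p * q)@_m = \sum_(k <- ks) p@_k * q@_(m - k).
Proof.
move=> uks lek supp.
have -> : (p * q)@_m = \sum_(k : 'X_{1..n < (mdeg m).+1} | (k <= m)%MM)
    p@_k * q@_(m - k) by exact: mcoeff_poly_mul_lin.
pose I : subFinType _ := 'X_{1..n < (mdeg m).+1}.
rewrite (big_mksub I (F := fun k => p@_k * q@_(m - k))) //=; last first.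
  by move=> k /lek km; rewrite ltnS -(submK km) mdegD leq_addl.
rewrite [LHS]big_mkcond [RHS]big_mkcond; apply: eq_bigr => k _ /=.
case: ifPn => km; case: ifPn => kks //; first by rewrite supp ?mul0r.
by rewrite lek in km.
Qed.

Section Monomial.
Variables (K : fieldType) (n : nat).

Definition monomial_mx (s : 'I_n -> 'I_n) (d : 'I_n -> K) : 'M_n :=
  \matrix_(i, j) (d i *+ (j == s i)).

Lemma monomial_mxM s e (d f : 'I_n -> K) :
  monomial_mx s d *m monomial_mx e f
  = monomial_mx (e \o s) (fun i => d i * f (s i)).
Proof.
apply/matrixP => i j; rewrite !mxE (bigD1 (s i)) //= !mxE eqxx mulr1n.
rewrite big1 ?addr0 ?mulrnAr // => k /negPf ks.
by rewrite mxE ks mulr0n mul0r.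
Qed.

Lemma lsubst_monomial_mx s d i :
  lsubst idfun (monomial_mx s d) 'X_i = d i *: 'X_(s i).
Proof.
rewrite lsubstX (bigD1 (s i)) //= mxE eqxx mulr1n big1 ?addr0 // => j.
by move/negPf => js; rewrite mxE js mulr0n scale0r.
Qed.

Lemma lsubst_monomial_mxXm s d (u : 'X_{1..n}) : involutive s ->
  lsubst idfun (monomial_mx s d) 'X_[u]
  = (\prod_i d i ^+ u i) *: 'X_[[multinom u (s i) | i < n]].
Proof.
move=> sK; rewrite lsubstXm.
under eq_bigr => i _ do rewrite lsubst_monomial_mx exprZn.
rewrite scaler_prod [in RHS]mpolyXE_id; congr (_ *: _).
rewrite (reindex_inj (inv_inj sK)); apply: eq_bigr => i _.
by rewrite mnmE sK.
Qed.

(** A monomial substitution permutes monomials up to scalars. *)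
Lemma mcoeff_lsubst_monomial_mx s d q (u : 'X_{1..n}) : involutive s ->
  (lsubst idfun (monomial_mx s d) q)@_[multinom u (s i) | i < n]
  = (\prod_i d i ^+ u i) * q@_u.
Proof.
move=> sK; rewrite {1}[q]mpolyE rmorph_sum raddf_sum /=.
have sm_inj : injective (fun v : 'X_{1..n} => [multinom v (s i) | i < n]).
  move=> v v' /mnmP e; apply/mnmP => i; have := e (s i).
  by rewrite !mnmE sK.
transitivity (\sum_(v <- msupp q | v == u) (\prod_i d i ^+ v i) * q@_v).
  rewrite [RHS]big_mkcond; apply: eq_bigr => v _.
  rewrite lsubstZ lsubst_monomial_mxXm // !mcoeffZ mcoeffX.
  rewrite (inj_eq sm_inj).
  by case: eqP => _; rewrite ?mulr0 // mulr1 mulrC.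
have [uq|uq] := boolP (u \in msupp q).
  rewrite big_mkcond (bigD1_seq u) ?msupp_uniq //= eqxx.
  rewrite [X in _ + X]big1 ?addr0 // => v.
  by move/negPf => ->.
rewrite (memN_msupp_eq0 uq) mulr0 big1_seq // => v /andP[/eqP -> vq].
by rewrite vq in uq.
Qed.

End Monomial.

(** The exponent vectors bounded entrywise by [l], as an explicit list. *)
Fixpoint box (l : seq nat) : seq (seq nat) :=
  if l is b :: l' then [seq x :: y | x <- iota 0 b.+1, y <- box l']
  else [:: [::]].

Lemma mem_box x l : (x \in box l) = all2 leq x l.
Proof.
elim: l x => [|b l IH] [|a x] //.
  by apply/negbTE/negP => /allpairsP[[? ?] [_ _ /=]].
rewrite [RHS]/=; apply/allpairsP/andP => [[[a' x'] [ha hx [-> ->]]]|[ha hx]].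
  by rewrite mem_iota in ha; rewrite -IH.
by exists (a, x); split; rewrite ?mem_iota ?IH.
Qed.

Lemma size_box x l : x \in box l -> size x = size l.
Proof.
rewrite mem_box; elim: l x => [|b l IH] [|a x] //= /andP[_ /IH ->].
by [].
Qed.

Lemma box_uniq l : uniq (box l).
Proof.
elim: l => // b l IH; apply: allpairs_uniq; rewrite ?iota_uniq //.
by move=> [a x] [a' x'] /= _ _ [-> ->].
Qed.

Section LowerBound.

Variables (K : fieldType) (w : K).
Hypothesis w_root : w ^+ 2 + w + 1 = 0.
Hypothesis nz2 : 2%:R != 0 :> K.
Hypothesis nz3 : 3%:R != 0 :> K.

Let w3 : w ^+ 3 = 1. Proof. exact: cube_root_exp3. Qed.

(** In the order x, y, x', y', u of the coordinates, [swap] exchanges x with y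
    and x' with y', and the matrices below are the actions of t, b and c. *)
Definition swap (i : 'I_5) : 'I_5 :=
  nth i [:: @Ordinal 5 1 isT; @Ordinal 5 0 isT; @Ordinal 5 3 isT;
            @Ordinal 5 2 isT; @Ordinal 5 4 isT] i.

Lemma swapK : involutive swap.
Proof. by move=> -[[|[|[|[|[|//]]]]] ?]; apply: val_inj. Qed.

Definition rot_mx : 'M[K]_5 :=
  monomial_mx id (fun i => nth 0 [:: w; w ^+ 2; w; w ^+ 2; 1] i).
Definition swap_mx : 'M[K]_5 :=
  monomial_mx swap (fun i => nth 0 [:: 1; -1; 1; -1; 1] i).
Definition sign_mx : 'M[K]_5 :=
  monomial_mx id (fun i => nth 0 [:: 1; 1; -1; -1; -1] i).

(** Multinomials in five variables are written as lists, so that the finite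
    enumeration of their factorisations is done by computation. *)
Definition expon (l : seq nat) : 'X_{1..5} := [multinom nth 0%N l i | i < 5].
Definition exponents (u : 'X_{1..5}) : seq nat := [seq u i | i <- enum 'I_5].

Lemma exponentsE u : exponents u = [:: u (@Ordinal 5 0 isT); u (@Ordinal 5 1 isT);
  u (@Ordinal 5 2 isT); u (@Ordinal 5 3 isT); u (@Ordinal 5 4 isT)].
Proof.
rewrite /exponents !enum_ordSl /= (_ : enum 'I_0 = [::]) //=.
  by do !congr cons; congr (u _); apply: val_inj.
by apply/eqP; rewrite -size_eq0 size_enum_ord.
Qed.

Lemma size_exponents u : size (exponents u) = 5.
Proof. by rewrite exponentsE. Qed.

Lemma exponentsK u : expon (exponents u) = u.
Proof.
apply/mnmP => i; rewrite mnmE exponentsE.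
by case: i => [[|[|[|[|[|//]]]]] ?] /=; congr (u _); apply: val_inj.
Qed.

Lemma exponK l : size l = 5 -> exponents (expon l) = l.
Proof.
move=> sl; rewrite exponentsE !mnmE /=.
by case: l sl => [|a [|b [|c [|d [|e [|? ?]]]]]].
Qed.

Lemma prod5 (f : 'I_5 -> K) :
  \prod_i f i = f (@Ordinal 5 0 isT) * (f (@Ordinal 5 1 isT) *
  (f (@Ordinal 5 2 isT) * (f (@Ordinal 5 3 isT) * f (@Ordinal 5 4 isT)))).
Proof.
rewrite !big_ord_recl big_ord0 mulr1.
by do !congr (_ * _); congr (f _); apply: val_inj.
Qed.

Definition generator_invariant (q : {mpoly K[5]}) :=
  [/\ lsubst idfun rot_mx q = q, lsubst idfun swap_mx q = q
    & lsubst idfun sign_mx q = q].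

(** The weight of the monomial is zero: the three conditions come from t, z and
    c. *)
Definition balanced (l : seq nat) :=
  [&& 3 %| nth 0 l 0 + 2 * nth 0 l 1 + nth 0 l 2 + 2 * nth 0 l 3,
      ~~ odd (nth 0 l 0 + nth 0 l 1 + nth 0 l 2 + nth 0 l 3)
    & ~~ odd (nth 0 l 2 + nth 0 l 3 + nth 0 l 4)]%N.

Local Notation "q @[ l ]" := (q@_(expon l%N)) (at level 2, l at level 50).

Lemma exp_w_dvd k : w ^+ k = 1 -> (3 %| k)%N.
Proof.
have w1 : w != 1.
  by apply: contra_neq nz3 => e; rewrite -w_root e; ring.
rewrite -(expr_mod k w3) /dvdn; case: (k %% 3)%N (ltn_pmod k (isT : 0 < 3)%N).
  by [].
case=> [_ /eqP|]; first by rewrite expr1 (negPf w1).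
case=> // _ e; case/eqP: w1.
by rewrite -[LHS]mul1r -e -exprSr w3.
Qed.

Lemma exp_N1_odd k : (-1) ^+ k = 1 :> K -> ~~ odd k.
Proof.
rewrite -signr_odd; case: odd => // e; case/eqP: nz2.
by rewrite -[2%:R]/(1 + 1) -{1}e expr1 addNr.
Qed.

Lemma coef_rot q l : size l = 5 -> lsubst idfun rot_mx q = q ->
  q@[l] = w ^+ (nth 0 l 0 + 2 * nth 0 l 1 + nth 0 l 2 + 2 * nth 0 l 3)%N * q@[l].
Proof.
move=> sl iq; rewrite -{1}iq.
have {1}-> : expon l = [multinom expon l (id i) | i < 5].
  by apply/mnmP => i; rewrite mnmE.
rewrite mcoeff_lsubst_monomial_mx // prod5 !mnmE /=; congr (_ * _).
by rewrite expr1n mulr1 -!exprM -!exprD !addnA.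
Qed.

Lemma coef_sign q l : size l = 5 -> lsubst idfun sign_mx q = q ->
  q@[l] = (-1) ^+ (nth 0 l 2 + nth 0 l 3 + nth 0 l 4)%N * q@[l].
Proof.
move=> sl iq; rewrite -{1}iq.
have {1}-> : expon l = [multinom expon l (id i) | i < 5].
  by apply/mnmP => i; rewrite mnmE.
rewrite mcoeff_lsubst_monomial_mx // prod5 !mnmE /=; congr (_ * _).
by rewrite !expr1n !mul1r -!exprD !addnA.
Qed.

Lemma coef_swap q a b c d e : lsubst idfun swap_mx q = q ->
  q@[[:: b; a; d; c; e]] = (-1) ^+ (b + d)%N * q@[[:: a; b; c; d; e]].
Proof.
move=> iq; rewrite -{1}iq.
have -> : expon [:: b; a; d; c; e]
    = [multinom expon [:: a; b; c; d; e] (swap i) | i < 5].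
  by apply/mnmP => -[[|[|[|[|[|//]]]]] ?]; rewrite !mnmE.
rewrite mcoeff_lsubst_monomial_mx; last exact: swapK.
by rewrite prod5 !mnmE /= !expr1n !mul1r mulr1 exprD.
Qed.

(** The parity condition for z is obtained from b, whose square is z. *)
Lemma balanced_coef q l : size l = 5 -> generator_invariant q ->
  q@[l] != 0 -> balanced l.
Proof.
move=> sl [irot iswap isign] nz.
have one a : q@[l] = a * q@[l] -> a = 1.
  by move=> e; apply: (mulIf nz); rewrite mul1r -e.
apply/and3P; split.
- by apply/exp_w_dvd/one/coef_rot.
- case: l sl nz one => [|a [|b [|c [|d [|e [|? ?]]]]]] // _ nz one.
  apply/exp_N1_odd/one => /=.
  have := coef_swap b a d c e iswap; rewrite (coef_swap a b c d e iswap) mulrA.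
  by rewrite -exprD addnACA addnA.
- by apply/exp_N1_odd/one/coef_sign.
Qed.

Lemma exponents_box u v : (exponents u \in box (exponents v)) = (u <= v)%MM.
Proof.
rewrite mem_box !exponentsE /=; apply/idP/mnm_lepP => [/and5P[h0 h1 h2 h3]|h].
  move/andP=> [h4 _] -[[|[|[|[|[|//]]]]] lti].
  - by rewrite (_ : Ordinal lti = @Ordinal 5 0 isT) //; apply: val_inj.
  - by rewrite (_ : Ordinal lti = @Ordinal 5 1 isT) //; apply: val_inj.
  - by rewrite (_ : Ordinal lti = @Ordinal 5 2 isT) //; apply: val_inj.
  - by rewrite (_ : Ordinal lti = @Ordinal 5 3 isT) //; apply: val_inj.
  - by rewrite (_ : Ordinal lti = @Ordinal 5 4 isT) //; apply: val_inj.
by rewrite !h.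
Qed.

Lemma coefM_balanced p q l : size l = 5 -> generator_invariant p ->
  (p * q)@[l] = \sum_(x <- box l | balanced x)
     p@[x] * q@[[seq ab.1 - ab.2 | ab <- zip l x]%N].
Proof.
move=> sl ip; rewrite -big_filter; set xs := filter _ _.
have size_xs x : x \in xs -> size x = 5.
  by rewrite mem_filter -sl => /andP[_ /size_box].
rewrite (@mcoeffM_support _ _ p q _ (map expon xs)).
- rewrite big_map big_seq [RHS]big_seq; apply: eq_bigr => x xxs.
  congr (_ * _@_ _); apply/mnmP => i; rewrite !mnmE.
  have sx := size_xs x xxs.
  rewrite (nth_map (0, 0)%N) ?size_zip ?sl ?sx // nth_zip ?sl ?sx //=.
- rewrite map_inj_in_uniq ?filter_uniq ?box_uniq // => x y xx yy exy.
  by rewrite -(exponK (size_xs x xx)) exy exponK ?size_xs.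
- move=> _ /mapP[x xx ->]; rewrite -exponents_box !exponK ?(size_xs x) //.
  by move: xx; rewrite mem_filter => /andP[].
move=> k km kxs; apply/eqP; apply: contraNT kxs => nz.
rewrite -[k]exponentsK; apply: map_f; rewrite mem_filter.
rewrite -(exponentsK k) in nz; rewrite (balanced_coef _ ip nz) ?size_exponents //=.
by move: km; rewrite -exponents_box exponK.
Qed.

(** The coefficient of x^6 y x' u alone does not vanish on decomposable
    invariants, since x^6 + y^6 and y x' u - x y' u are invariant; adding the
    coefficient of x^7 y' u repairs this. *)
Definition probe (q : {mpoly K[5]}) : K :=
  q@[[:: 6; 1; 1; 0; 1]] + q@[[:: 7; 0; 0; 1; 1]].

(** The generator b maps xy to -xy. *)
Lemma coef_xy q : generator_invariant q -> q@[[:: 1; 1; 0; 0; 0]] = 0.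
Proof.
case=> _ iq _; have := coef_swap 1 1 0 0 0 iq; rewrite expr1 mulN1r => e.
by apply: (mulfI nz2); rewrite mulr0 mulr_natl mulr2n {1}e addNr.
Qed.

Lemma probeM p q : generator_invariant p -> generator_invariant q ->
  probe (p * q) = p@[[:: 0; 0; 0; 0; 0]] * probe q
                + q@[[:: 0; 0; 0; 0; 0]] * probe p.
Proof.
move=> ip iq.
have e1 := coefM_balanced q (erefl : size [:: 6; 1; 1; 0; 1]%N = 5) ip.
have e2 := coefM_balanced q (erefl : size [:: 7; 0; 0; 1; 1]%N = 5) ip.
rewrite -big_filter in e1; rewrite -big_filter in e2.
have f1 : filter balanced (box [:: 6; 1; 1; 0; 1]%N)
  = [:: [:: 0; 0; 0; 0; 0]; [:: 0; 1; 1; 0; 1]; [:: 1; 1; 0; 0; 0];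
        [:: 5; 0; 1; 0; 1]; [:: 6; 0; 0; 0; 0]; [:: 6; 1; 1; 0; 1]]%N by [].
have f2 : filter balanced (box [:: 7; 0; 0; 1; 1]%N)
  = [:: [:: 0; 0; 0; 0; 0]; [:: 1; 0; 0; 1; 1]; [:: 6; 0; 0; 0; 0];
        [:: 7; 0; 0; 1; 1]]%N by [].
rewrite f1 !big_cons big_nil in e1; rewrite f2 !big_cons big_nil in e2.
rewrite /probe e1 e2 {e1 e2 f1 f2} /=.
rewrite (coef_xy ip) (coef_xy iq).
have [_ sp _] := ip; have [_ sq _] := iq.
rewrite (coef_swap 0 1 1 0 1 sp) (coef_swap 0 1 1 0 1 sq).
rewrite [(1 + 0)%N]/= expr1 mul0r mulr0 !subn0 !subnn -[(7 - 1)%N]/6%N.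
move: (p@[[:: 0; 0; 0; 0; 0]]) (q@[[:: 0; 0; 0; 0; 0]]).
move: (p@[[:: 0; 1; 1; 0; 1]]) (q@[[:: 0; 1; 1; 0; 1]]).
move: (p@[[:: 6; 0; 0; 0; 0]]) (q@[[:: 6; 0; 0; 0; 0]]).
move: (p@[[:: 6; 1; 1; 0; 1]]) (q@[[:: 6; 1; 1; 0; 1]]).
move: (p@[[:: 7; 0; 0; 1; 1]]) (q@[[:: 7; 0; 0; 1; 1]]) => *.
by ring.
Qed.

Definition witness : {mpoly K[5]} :=
  'X_[expon [:: 6; 1; 1; 0; 1]%N] - 'X_[expon [:: 1; 6; 0; 1; 1]%N].

Lemma probe_witness : probe witness = 1.
Proof.
rewrite /probe !mcoeffB !mcoeffX.
have inj l l' : size l = 5 -> size l' = 5 -> (expon l == expon l') = (l == l').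
  by move=> sl sl'; apply/eqP/eqP => [e|-> //]; rewrite -(exponK sl) e exponK.
by rewrite !inj //= subr0 subrr addr0.
Qed.

Lemma generator_invariant_witness : generator_invariant witness.
Proof.
have idE u : [multinom (u : 'X_{1..5}) (id i) | i < 5] = u.
  by apply/mnmP => i; rewrite mnmE.
have swapE a b c d e : [multinom expon [:: a; b; c; d; e] (swap i) | i < 5]
    = expon [:: b; a; d; c; e].
  by apply/mnmP => -[[|[|[|[|[|//]]]]] ?]; rewrite !mnmE.
have w3k k : w ^+ (3 * k)%N = 1 by rewrite exprM w3 expr1n.
have idK : involutive (id : 'I_5 -> 'I_5) by [].
split; rewrite /witness rmorphB /=.
- rewrite !(lsubst_monomial_mxXm _ _ idK) !idE !prod5 !mnmE /= !expr1n.
  rewrite !mulr1 -!exprM -!exprD.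
  by rewrite (w3k 3) (w3k 5) !scale1r.
- rewrite !(lsubst_monomial_mxXm _ _ swapK) !swapE !prod5 !mnmE /= !expr1n.
  have n6 : (-1) ^+ 6 = 1 :> K by rewrite -signr_odd.
  rewrite ?n6 ?expr0 ?expr1 ?mulr1 ?mul1r.
  by rewrite !scaleN1r opprK addrC.
- rewrite !(lsubst_monomial_mxXm _ _ idK) !idE !prod5 !mnmE /= !expr1n.
  by rewrite ?expr0 ?expr1 ?mul1r mulrNN ?mulr1 !scale1r.
Qed.

Lemma probe_homog d q : (d <= 8)%N -> q \is d.-homog -> probe q = 0.
Proof.
move=> d8 hq; have deg9 l : mdeg (expon l) = 9 -> q@[l] = 0.
  move=> e; apply: (dhomog_nemf_coeff hq); rewrite /= e.
  by apply: contraTneq d8 => <-.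
by rewrite /probe !deg9 ?addr0 // mdegE !big_ord_recl big_ord0 !mnmE.
Qed.

(** By [probeM] the functional [probe] vanishes on products of invariants killed
    by it, and it vanishes on scalars and in degrees up to 8; so it would kill
    [witness]. *)
Theorem generated_upto_gt8 (gT : finGroupType) (G : {group gT})
    (rG : mx_representation K G 5) d :
    (exists2 g, g \in G & rG g = rot_mx) ->
    (exists2 g, g \in G & rG g = swap_mx) ->
    (exists2 g, g \in G & rG g = sign_mx) ->
    sym_invariant rG witness ->
  invariants_generated_upto rG d -> (8 < d)%N.
Proof.
move=> [r Gr rE] [s Gs sE] [c Gc cE] iw gen; rewrite ltnNge; apply/negP => d8.
have ginv q : sym_invariant rG q -> generator_invariant q.
  by move=> iq; split; rewrite -?rE -?sE -?cE -sym_actE iq.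
suff [_] : sym_invariant rG witness /\ probe witness = 0.
  by rewrite probe_witness => /eqP; rewrite oner_eq0.
elim: (gen _ iw) => [q [iq [k kd hq]]|a|p q _ [ip p0] _ [iq q0]
  |p q _ [ip p0] _ [iq q0]].
- by split=> //; apply: probe_homog hq; apply: leq_trans d8.
- split=> [g _|]; first by rewrite sym_actZ rmorph1.
  by apply: (@probe_homog 0) => //; apply/rpredZ/dhomog1.
- split=> [g Gg|]; first by rewrite rmorphD /= ip ?iq.
  by rewrite /probe !mcoeffD addrACA -/(probe p) -/(probe q) p0 q0 addr0.
- split=> [g Gg|]; first by rewrite rmorphM /= ip ?iq.
  by rewrite probeM ?p0 ?q0 ?mulr0 ?addr0 //; apply: ginv.
Qed.

End LowerBound.

(** * The dicyclic group of order 12 *)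

(** A concrete model, the semidirect product of Z/3 by Z/4 acting by signs: the
    presentation alone does not show that the group has no further
    relations. *)
Definition dicyclic12 := ('Z_3 * 'Z_4)%type.

HB.instance Definition _ := Finite.on dicyclic12.

Definition dic_mul (g h : dicyclic12) : dicyclic12 :=
  (g.1 + (-1) ^+ g.2 * h.1, g.2 + h.2).
Definition dic_inv (g : dicyclic12) : dicyclic12 :=
  (- ((-1) ^+ g.2 * g.1), - g.2).

Lemma exp_N1_Z4 (i j : 'Z_4) : (-1) ^+ (i + j)%R = (-1) ^+ i * (-1) ^+ j :> 'Z_3.
Proof.
have e : (-1) ^+ 4 = 1 :> 'Z_3 by apply/eqP.
by rewrite -exprD /= (expr_mod _ e).
Qed.

Lemma dic_mulA : associative dic_mul.
Proof.
move=> g h k; rewrite /dic_mul /= exp_N1_Z4; congr pair; last exact: addrA.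
by rewrite mulrDr mulrA addrA.
Qed.

Lemma dic_mul1 : left_id ((0, 0) : dicyclic12) dic_mul.
Proof. by case=> s r; rewrite /dic_mul /= expr0 mul1r !add0r. Qed.

Lemma dic_mulV : left_inverse ((0, 0) : dicyclic12) dic_inv dic_mul.
Proof.
case=> s r; rewrite /dic_mul /dic_inv /=; congr pair; last exact: addNr.
suff -> : (-1) ^+ (- r)%R = (-1) ^+ r :> 'Z_3 by rewrite addNr.
by case: r => -[|[|[|[|//]]]] ?; apply/eqP.
Qed.

HB.instance Definition _ :=
  Finite_isGroup.Build dicyclic12 dic_mulA dic_mul1 dic_mulV.

Definition dic_a : dicyclic12 := (1, 2).
Definition dic_b : dicyclic12 := (0, 1).

(** Here a^4 = (1, 0) and b = (0, 1) generate the two factors. *)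
Lemma dic_word (g : dicyclic12) : g = (dic_a ^+ (4 * g.1) * dic_b ^+ g.2)%g.
Proof.
by case: g => -[[|[|[|//]]] ?] [[|[|[|[|//]]]] ?]; apply/eqP.
Qed.

Lemma dicyclic12_presentation :
  ([set: dicyclic12] \homg
    Grp (a : b : a ^+ 6, b ^+ 2 = a ^+ 3, b * a * b^-1 = a^-1))%g.
Proof.
apply/existsP; exists (dic_a, dic_b); rewrite /= !xpair_eqE.
do ?[apply/andP; split] => //.
rewrite eqEsubset subsetT /=; apply/subsetP => g _; rewrite (dic_word g).
by rewrite groupM ?groupX // mem_gen // inE cycle_id ?orbT.
Qed.

Section DicyclicTimesC2.

Variables (gT hT : finGroupType) (Dic12 : {group gT}) (C2 : {group hT}).
Hypothesis hDic12 : (Dic12 \isog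
       Grp (a : b : a ^+ 6, b ^+ 2 = a ^+ 3, b * a * b^-1 = a^-1))%g.
Hypothesis cyclicC2 : cyclic C2.
Hypothesis cardC2 : #|C2| = 2.

Lemma dicyclic_generators : exists x y : gT,
  [/\ (<[x]> <*> <[y]> = Dic12)%g, (x ^+ 6 = 1)%g, (y ^+ 2 = x ^+ 3)%g
    & (y * x * y^-1 = x^-1)%g].
Proof.
have /existsP[[x y] /=] := isoGrp_hom hDic12.
rewrite !xpair_eqE => /and4P[/eqP D /eqP x6 /eqP yx /eqP yxy].
by exists x, y.
Qed.

Lemma C2_generator : exists2 c,
  C2 = [set 1; c]%g :> {set hT} & (c != 1 /\ c ^+ 2 = 1)%g.
Proof.
have /cyclicP[c cE] := cyclicC2.
have oc : #[c]%g = 2 by rewrite orderE -cE cardC2.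
exists c; first by rewrite cE cycle2g.
by split; [rewrite -order_eq1 oc | apply/eqP; rewrite -order_dvdn oc].
Qed.

(** The cyclic subgroup of the second generator normalises that of the first,
    and their orders divide 4 and 6. *)
Lemma card_dicyclic_dvd : (#|Dic12| %| 24)%N.
Proof.
have [x [y [D x6 yx yxy]]] := dicyclic_generators.
have ox : (#[x]%g %| 6)%N by rewrite order_dvdn x6.
have oy : (#[y]%g %| 4)%N by rewrite order_dvdn (expgM y 2 2) yx -expgM x6.
have ny : <[y]>%g \subset ('N(<[x]>))%g.
  rewrite cycle_subG -groupV; apply/normP.
  by rewrite -cycleJ conjgE invgK mulgA yxy cycleV.
rewrite -D (norm_joinEr ny).
apply: dvdn_trans (dvdn_mul ox oy); rewrite !orderE mul_cardG.
exact: dvdn_mulr.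
Qed.

Lemma card_prod_neq0 (F : fieldType) : 2%:R != 0 :> F -> 3%:R != 0 :> F ->
  #|setX_group Dic12 C2|%:R != 0 :> F.
Proof.
move=> n2 n3; rewrite cardsX cardC2 natrM mulf_neq0 //.
have /dvdnP[k e] := card_dicyclic_dvd.
have : 24%:R != 0 :> F.
  by rewrite (_ : 24 = 2 * 2 * 2 * 3)%N // !natrM !mulf_neq0.
by apply: contraNneq => z; rewrite e natrM z mulr0.
Qed.

(** The group is generated by t = a^4, z = a^3, c and b, because a = t z. *)
Lemma dicyclic_prod_C2_upto9 (K : fieldType) (w : K) n
    (rG : mx_representation K (setX_group Dic12 C2) n) :
    w ^+ 2 + w + 1 = 0 -> 2%:R != 0 :> K -> 3%:R != 0 :> K ->
  invariants_generated_upto rG 9.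
Proof.
move=> w_root n2 n3.
have [x [y [D x6 yx yxy]]] := dicyclic_generators.
have [c C2E [c1 cc]] := C2_generator.
have yx' : (y * x = x^-1 * y)%g by rewrite -yxy mulgKV.
have yxk k : (y * x ^+ k = x ^- k * y)%g.
  elim: k => [|k IH]; first by rewrite !expg0 invg1 mulg1 mul1g.
  by rewrite {1}expgSr mulgA IH -mulgA yx' mulgA -invMg -expgS.
pose t := (x ^+ 4, 1 : hT)%g; pose z := (x ^+ 3, 1 : hT)%g.
pose b := (y, 1 : hT)%g; pose d := (1 : gT, c)%g.
have pairX (u : gT) (v : hT) k : ((u, v) ^+ k = (u ^+ k, v ^+ k))%g.
  by elim: k => // k IH; rewrite !expgS IH.
have pairM (u u' : gT) (v v' : hT) : ((u, v) * (u', v') = (u * u', v * v'))%g.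
  by [].
have pairV (u : gT) (v : hT) : ((u, v)^-1 = (u^-1, v^-1))%g by [].
apply: (@generated_upto9 K w _ _ n rG t z d b) => //.
- exact: card_prod_neq0.
- set S := [set t; z; d; b].
  have tS : t \in <<S>>%g by rewrite mem_gen // !inE eqxx ?orbT.
  have zS : z \in <<S>>%g by rewrite mem_gen // !inE eqxx ?orbT.
  have dS : d \in <<S>>%g by rewrite mem_gen // !inE eqxx ?orbT.
  have bS : b \in <<S>>%g by rewrite mem_gen // !inE eqxx ?orbT.
  apply/eqP; rewrite eqEsubset; apply/andP; split; last first.
    have xD : x \in Dic12 by rewrite -D mem_gen // inE cycle_id.
    have yD : y \in Dic12 by rewrite -D mem_gen // inE cycle_id orbT.
    have cC : c \in C2 by rewrite C2E !inE eqxx orbT.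
    rewrite gen_subG; apply/subsetP => g; rewrite !inE -!orbA.
    by case/or4P=> /eqP -> /=; rewrite ?groupX ?group1 ?xD ?yD ?cC.
  have sub : Dic12 \subset (@pairg1 gT hT @*^-1 <<S>>)%g.
    rewrite -D join_subG !cycle_subG; apply/andP; split; apply/morphpreP; split;
      rewrite ?inE //.
    (* a = a^7 = a^4 a^3 *)
    suff e : pairg1 hT x = (t * z)%g by rewrite [_ x]e groupM.
    by rewrite pairM -expgD (expgD x 6 1) x6 mul1g mulg1.
  apply/subsetP => -[g h]; rewrite inE /= => /andP[gD hC].
  have -> : (g, h) = ((g, 1) * (1, h))%g by rewrite pairM mulg1 mul1g.
  apply: groupM; first by have /morphpreP[] := subsetP sub g gD.
  move: hC; rewrite C2E !inE => /orP[/eqP ->|/eqP -> //]; exact: group1.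
- by rewrite pairX expg1n -expgM (expgM x 6 2) x6 expg1n.
- by rewrite pairX expg1n -expgM x6.
- by rewrite pairX expg1n cc.
- by rewrite pairX expg1n yx.
- by rewrite /commute !pairM -!expgD.
- by rewrite /commute !pairM !mulg1 !mul1g.
- by rewrite /commute !pairM !mulg1 !mul1g.
- by rewrite /commute !pairM !mulg1 !mul1g.
- by rewrite pairV !pairM yxk invg1.
Qed.

(** * The lower bound for the regular representation *)

Section WitnessRepresentation.

Variables (K : fieldType) (w : K).
Hypothesis w_root : w ^+ 2 + w + 1 = 0.

Local Notation rot := (rot_mx w : 'M[K]_5).
Local Notation swp := (swap_mx K : 'M[K]_5).
Local Notation sgn := (sign_mx K : 'M[K]_5).

Lemma eq_monomial_mx n (s s' : 'I_n -> 'I_n) (f f' : 'I_n -> K) :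
  s =1 s' -> f =1 f' -> monomial_mx s f = monomial_mx s' f'.
Proof. by move=> es ef; apply/matrixP => i j; rewrite !mxE es ef. Qed.

Lemma monomial_mx1 n : monomial_mx id (fun=> 1) = 1%:M :> 'M[K]_n.
Proof. by apply/matrixP => i j; rewrite !mxE eq_sym. Qed.

Lemma rot3 : rot ^+ 3 = 1.
Proof.
have w3 : w * (w * w) = 1 by rewrite -!expr2 -exprS cube_root_exp3.
have w6 : w ^+ 2 * (w ^+ 2 * w ^+ 2) = 1.
  have -> : w ^+ 2 * (w ^+ 2 * w ^+ 2) = (w * (w * w)) ^+ 2 by ring.
  by rewrite w3 expr1n.
rewrite !exprS expr0 mulr1 -!mulmxE !monomial_mxM -[RHS]monomial_mx1.
by apply: eq_monomial_mx => // -[[|[|[|[|[|//]]]]] ?]; rewrite /= ?mulr1.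
Qed.

Lemma swap4 : swp ^+ 4 = 1.
Proof.
rewrite !exprS expr0 mulr1 -!mulmxE !monomial_mxM -[RHS]monomial_mx1.
apply: eq_monomial_mx => [i|]; first by rewrite /= !swapK.
by move=> -[[|[|[|[|[|//]]]]] ?]; rewrite /= ?mulr1 ?mul1r ?mulrNN ?mulr1.
Qed.

Lemma sign2 : sgn ^+ 2 = 1.
Proof.
rewrite expr2 -!mulmxE !monomial_mxM -[RHS]monomial_mx1.
by apply: eq_monomial_mx => // -[[|[|[|[|[|//]]]]] ?]; rewrite /= ?mulrNN ?mulr1.
Qed.

Lemma swap_rot : swp * rot = rot ^+ 2 * swp.
Proof.
have w4 : w ^+ 2 * w ^+ 2 = w.
  have -> : w ^+ 2 * w ^+ 2 = (w ^+ 2 - w) * (w ^+ 2 + w + 1) + w by ring.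
  by rewrite w_root mulr0 add0r.
rewrite expr2 -!mulmxE !monomial_mxM.
apply: eq_monomial_mx => // -[[|[|[|[|[|//]]]]] ?] /=;
  by rewrite ?mulr1 ?mul1r ?w4 // ?mulrN1 ?mulN1r ?w4.
Qed.

Lemma sign_rot : sgn * rot = rot * sgn.
Proof.
rewrite -!mulmxE !monomial_mxM.
by apply: eq_monomial_mx => // -[[|[|[|[|[|//]]]]] ?] /=; rewrite mulrC.
Qed.

Lemma sign_swap : sgn * swp = swp * sgn.
Proof.
rewrite -!mulmxE !monomial_mxM.
by apply: eq_monomial_mx => // -[[|[|[|[|[|//]]]]] ?] /=; rewrite mulrC.
Qed.

Definition dic_rep (g : dicyclic12) : 'M[K]_5 := rot ^+ g.1 * swp ^+ g.2.

Lemma dic_repM g h : dic_rep (g * h)%g = dic_rep g * dic_rep h.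
Proof.
have swap_rotX k : swp * rot ^+ k = rot ^+ (k * 2) * swp.
  elim: k => [|k IH]; first by rewrite mulr1 mul1r.
  by rewrite exprSr mulrA IH -mulrA swap_rot mulrA -exprD mulSn addnC.
have swapX_rotX r k : swp ^+ r * rot ^+ k = rot ^+ (k * 2 ^ r) * swp ^+ r.
  elim: r k => [|r IH] k; first by rewrite muln1 mulr1 mul1r.
  by rewrite exprS -mulrA IH mulrA swap_rotX -mulrA -mulnA -expnSr.
have rot_mod k : rot ^+ k = rot ^+ (k %% 3) by rewrite (expr_mod _ rot3).
case: g h => s r [s' r']; rewrite /dic_rep /=.
rewrite -[RHS]mulrA [swp ^+ r * _]mulrA swapX_rotX -!mulrA -exprD.
rewrite [RHS]mulrA -exprD (expr_mod _ swap4); congr (_ * _).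
rewrite rot_mod [RHS]rot_mod; congr (_ ^+ _).
by case: s s' r => [[|[|[|//]]] ?] [[|[|[|//]]] ?] [[|[|[|[|//]]]] ?].
Qed.

Variable f : {morphism Dic12 >-> dicyclic12}.
Hypothesis fD : (f @* Dic12)%g = [set: dicyclic12].

(** The second factor acts through its sign character, the first through a
    surjection [f] onto the model. *)
Definition witness_mx (g : gT * hT) : 'M[K]_5 :=
  dic_rep (f g.1) * sgn ^+ (g.2 != 1%g).

Lemma witness_mx_repr : mx_repr (setX_group Dic12 C2) witness_mx.
Proof.
have comm g : GRing.comm sgn (dic_rep g).
  by apply: commrM; apply: commrX; [exact: sign_rot | exact: sign_swap].
have commX k g : sgn ^+ k * dic_rep g = dic_rep g * sgn ^+ k.
  by apply/commr_sym/commrX/commr_sym/comm.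
have [c C2E [c1 cc]] := C2_generator.
split=> [|[g h] [g' h']].
  by rewrite /witness_mx morph1 eqxx mulr1 /dic_rep expr0 mulr1.
rewrite !inE /= => /andP[Gg Gh] /andP[Gg' Gh'].
rewrite /witness_mx /= morphM // dic_repM mulmxE.
move: (commX (h != 1%g) (f g')).
move: (dic_rep (f g)) (dic_rep (f g')) => A B AB.
rewrite -!mulrA [sgn ^+ _ * (B * _)]mulrA AB -mulrA -exprD; congr (_ * (_ * _)).
move: Gh Gh'; rewrite C2E !inE.
case/orP=> /eqP -> /orP[] /eqP ->; rewrite ?mul1g ?mulg1 ?eqxx ?addn0 //.
by rewrite -expg2 cc eqxx c1 sign2.
Qed.

Definition witness_repr := MxRepresentation witness_mx_repr.

Lemma witness_repr_invariant : sym_invariant witness_repr (witness K).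
Proof.
have [irot iswp isgn] := generator_invariant_witness w_root.
pose fixes M := lsubst idfun M (witness K) = witness K.
have fixM M N : fixes M -> fixes N -> fixes (M * N).
  rewrite /fixes => iM iN; rewrite -[RHS]iN -[in RHS]iM lsubst_comp.
  apply: eq_lsubst => //; rewrite -mulmxE; congr (_ *m _).
  by apply/matrixP => i j; rewrite mxE.
have fixX M k : fixes M -> fixes (M ^+ k).
  move=> iM; elim: k => [|k IH]; last by rewrite exprS; apply: fixM.
  rewrite /fixes expr0.
  have := sym_act1 witness_repr (witness K); rewrite sym_actE repr_mx1.
  exact.
move=> [g h] _; rewrite sym_actE; apply: (fixM); last exact: fixX.
by apply: fixM; apply: fixX.
Qed.

Lemma witness_repr_generators :
  [/\ exists2 g, g \in setX_group Dic12 C2 & witness_repr g = rot,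
      exists2 g, g \in setX_group Dic12 C2 & witness_repr g = swp
    & exists2 g, g \in setX_group Dic12 C2 & witness_repr g = sgn].
Proof.
have surj (u : dicyclic12) : exists2 g, g \in Dic12 & f g = u.
  have : u \in (f @* Dic12)%g by rewrite fD inE.
  by case/morphimP => g _ gD ->; exists g.
have [c C2E [c1 cc]] := C2_generator.
have [r rD fr] := surj (1, 0); have [s sD fs] := surj (0, 1).
split.
- exists (r, 1%g); first by rewrite !inE rD group1.
  by rewrite /= /witness_mx /= fr eqxx mulr1 /dic_rep /= expr0 mulr1 expr1.
- exists (s, 1%g); first by rewrite !inE sD group1.
  by rewrite /= /witness_mx /= fs eqxx mulr1 /dic_rep /= expr0 mul1r expr1.
- exists (1%g, c); first by rewrite !inE group1 C2E !inE eqxx orbT.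
  by rewrite /= /witness_mx /= morph1 c1 /dic_rep /= !expr0 !mul1r expr1.
Qed.

Lemma witness_repr_gt8 d : 2%:R != 0 :> K -> 3%:R != 0 :> K ->
  invariants_generated_upto witness_repr d -> (8 < d)%N.
Proof.
move=> n2 n3; have [hr hs hc] := witness_repr_generators.
exact (@generated_upto_gt8 K w w_root n2 n3 _ _ witness_repr d hr hs hc
         witness_repr_invariant).
Qed.

Section Regular.

Variables (F : fieldType) (iota : {rmorphism F -> K}).
Hypothesis n2 : 2%:R != 0 :> F.
Hypothesis n3 : 3%:R != 0 :> F.
Local Notation G := (setX_group Dic12 C2).

Let v0 : 'rV[K]_5 := \row_j nth 0 [:: 1; 0; 1; 0; 1] j.

(** The map from the regular representation that sends the identity to
    [v0] = x + x' + u. *)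
Definition cover_mx : 'M[K]_(gcard G, 5) :=
  \matrix_i (v0 *m witness_repr (enum_val i)).

Lemma cover_intertwining g : g \in G ->
  map_mx iota (regular_repr F G g) *m cover_mx = cover_mx *m witness_repr g.
Proof.
move=> Gg; rewrite /= map_regular_mx; apply/row_matrixP => i.
rewrite !row_mul !rowK -rowE rowK gring_indexK ?groupM ?enum_valP //.
by rewrite -mulmxA -repr_mxM ?enum_valP.
Qed.

(** The vector [v0] is cyclic: c isolates x, then z = b^2 separates u from x',
    and b yields y and y'. *)
Lemma cover_full : row_full cover_mx.
Proof.
have v0L : (v0 <= cover_mx)%MS.
  have -> : v0 = row (gring_index G 1%g) cover_mx.
    by rewrite rowK gring_indexK ?group1 // repr_mx1 mulmx1.
  exact: row_sub.
have stab g v : g \in G -> (v <= cover_mx)%MS -> (v *m witness_repr g <= cover_mx)%MS.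
  move=> Gg vL; apply: submx_trans (submxMr _ vL) _.
  apply/row_subP => i; rewrite row_mul rowK -mulmxA -repr_mxM ?enum_valP //.
  rewrite -[(enum_val i * g)%g](@gring_indexK _ G) ?groupM ?enum_valP //.
  have -> j : v0 *m witness_repr (enum_val j) = row j cover_mx by rewrite rowK.
  exact: row_sub.
have [_ [s Gs sE] [c Gc cE]] := witness_repr_generators.
have n2K : 2%:R != 0 :> K by rewrite -(rmorph_nat iota) fmorph_eq0.
pose e k lt_k5 : 'rV[K]_5 := delta_mx 0 (@Ordinal 5 k lt_k5).
have e_mono i t m : delta_mx 0 i *m monomial_mx t m
    = m i *: delta_mx 0 (t i) :> 'rV[K]_5.
  apply/rowP => j; rewrite -rowE !mxE.
  by case: eqP; rewrite ?mulr1n ?mulr0n ?mulr1 ?mulr0.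
have half (v : 'rV[K]_5) : ((v + v)%R <= cover_mx)%MS -> (v <= cover_mx)%MS.
  by rewrite -mulr2n -scaler_nat (eqmx_scale _ n2K).
have v0E : v0 = e 0 isT + e 2 isT + e 4 isT.
  apply/rowP => j; rewrite !mxE.
  by case: j => -[|[|[|[|[|//]]]]] ?; rewrite /= ?addr0 ?add0r.
have swL (u v : 'rV_5) : (u <= cover_mx)%MS -> u *m swp = v -> (v <= cover_mx)%MS.
  by move=> uL <-; rewrite -sE; apply: stab.
have sw k lt_k5 l lt_l5 : swap (@Ordinal 5 k lt_k5) = @Ordinal 5 l lt_l5 ->
    e k lt_k5 *m swp = nth 0 [:: 1; -1; 1; -1; 1] k *: e l lt_l5.
  by move=> kl; rewrite e_mono kl.
have e0L : (e 0 isT <= cover_mx)%MS.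
  apply: half; have -> : e 0 isT + e 0 isT = v0 + v0 *m sgn.
    rewrite v0E !mulmxDl !e_mono /= !scaleN1r scale1r.
    by rewrite addrACA subrr addr0 addrACA subrr addr0.
  by apply: addmx_sub => //; rewrite -cE; apply: stab.
have e1L : (e 1 isT <= cover_mx)%MS.
  by apply: swL e0L _; rewrite (sw _ _ 1 isT) ?scale1r //; apply: val_inj.
have e24L : ((e 2 isT + e 4 isT)%R <= cover_mx)%MS.
  have -> : e 2 isT + e 4 isT = v0 + (-1) *: e 0 isT.
    by rewrite v0E scaleN1r -[e 0 isT + _ + _]addrA [e 0 isT + _]addrC addrK.
  by apply: addmx_sub => //; apply: scalemx_sub.
have e4L : (e 4 isT <= cover_mx)%MS.
  apply: half; have -> : e 4 isT + e 4 isT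
      = (e 2 isT + e 4 isT) + (e 2 isT + e 4 isT) *m swp *m swp.
    rewrite !mulmxDl (sw 2 isT 3 isT) ?(sw 4 isT 4 isT); try exact: val_inj.
    rewrite /= !scale1r (sw 3 isT 2 isT) ?(sw 4 isT 4 isT); try exact: val_inj.
    by rewrite /= scaleN1r scale1r addrACA subrr add0r.
  by apply: addmx_sub => //; rewrite -sE; do 2!apply: (stab) => //.
have e2L : (e 2 isT <= cover_mx)%MS.
  have -> : e 2 isT = (e 2 isT + e 4 isT) + (-1) *: e 4 isT.
    by rewrite scaleN1r addrK.
  by apply: addmx_sub => //; apply: scalemx_sub.
have e3L : (e 3 isT <= cover_mx)%MS.
  by apply: swL e2L _; rewrite (sw _ _ 3 isT) ?scale1r //; apply: val_inj.
rewrite -sub1mx; apply/row_subP => i; rewrite row1.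
case: i => -[|[|[|[|[|//]]]]] lti.
- by rewrite (_ : Ordinal lti = @Ordinal 5 0 isT) //; apply: val_inj.
- by rewrite (_ : Ordinal lti = @Ordinal 5 1 isT) //; apply: val_inj.
- by rewrite (_ : Ordinal lti = @Ordinal 5 2 isT) //; apply: val_inj.
- by rewrite (_ : Ordinal lti = @Ordinal 5 3 isT) //; apply: val_inj.
- by rewrite (_ : Ordinal lti = @Ordinal 5 4 isT) //; apply: val_inj.
Qed.

Lemma regular_repr_gt8 d :
  invariants_generated_upto (regular_repr F G) d -> (8 < d)%N.
Proof.
move=> gen; have /row_fullP[L' L'K] := cover_full.
have nzG := card_prod_neq0 n2 n3.
apply: witness_repr_gt8; first by rewrite -(rmorph_nat iota) fmorph_eq0.
  by rewrite -(rmorph_nat iota) fmorph_eq0.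
exact: (generated_upto_image L'K cover_intertwining nzG gen).
Qed.

End Regular.

End WitnessRepresentation.

End DicyclicTimesC2.

Local Close Scope ring_scope.
Local Open Scope group_scope.

(** The regular representation attains the bound, so the supremum is exactly
    nine. *)
Theorem proposition3p4 (F : fieldType)
    (hchar2 : 2 \notin [pchar F]%R) (hchar3 : 3 \notin [pchar F]%R)
    (gT : finGroupType) (Dic12 : {group gT})
    (hDic12 : Dic12 \isog
       Grp (a : b : a ^+ 6, b ^+ 2 = a ^+ 3, b * a * b^-1 = a^-1))
    (hT : finGroupType) (C2 : {group hT})
    (cyclicC2 : cyclic C2) (cardC2 : #|C2| = 2) :
  is_noether_number F (setX_group Dic12 C2) 9.
Proof.
have n2 : 2%:R%R != 0%R :> F by move: hchar2; rewrite inE.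
have n3 : 3%:R%R != 0%R :> F by move: hchar3; rewrite inE.
have [K [iota [pi [w [pi_lin pi1 w_root]]]]] := cube_root_extension F.
have n2K : 2%:R%R != 0%R :> K by rewrite -(rmorph_nat iota) fmorph_eq0.
have n3K : 3%:R%R != 0%R :> K by rewrite -(rmorph_nat iota) fmorph_eq0.
have nzG := card_prod_neq0 hDic12 cardC2 n2 n3.
have upto9 n (rG : mx_representation F (setX_group Dic12 C2) n) :
    invariants_generated_upto rG 9.
  apply: (generated_upto_descent pi_lin pi1 nzG).
  exact: (dicyclic_prod_C2_upto9 hDic12 cyclicC2 cardC2 w_root n2K n3K).
have beta_exists n (rG : mx_representation F (setX_group Dic12 C2) n) :
    exists2 d, is_beta rG d & (d <= 9)%N.
  have least b : invariants_generated_upto rG b ->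
      exists2 d, is_beta rG d & (d <= b)%N.
    elim/ltn_ind: b => b IH gb.
    have [[d [db gd]]|no] := Classical_Prop.classic
      (exists d, (d < b)%N /\ invariants_generated_upto rG d).
      have [d' bd' dd'] := IH d db gd.
      by exists d' => //; apply: leq_trans dd' (ltnW db).
    exists b => //; split=> // d' gd'; rewrite leqNgt; apply/negP => db.
    by case: no; exists d'.
  exact: least (upto9 n rG).
split=> // c cb.
have [d bd d9] := beta_exists _ (regular_repr F (setX_group Dic12 C2)).
apply: leq_trans (cb _ _ _ bd).
have homf : [set: dicyclic12] \homg Dic12.
  by rewrite hDic12; apply: dicyclic12_presentation.
have /homgP[f fD] := homf.
have [gd _] := bd.
exact: (regular_repr_gt8 hDic12 cyclicC2 cardC2 w_root fD iota n2 n3 gd).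
Qed.
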